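(* Let $k_1\geq k_2\geq t+2$ with $(k_1,k_2)\neq(3,3)$, and let $n\geq 2L(k_1,t)$. If $\mathcal{F}_1\subseteq\Pi(n,k_1)$ and $\mathcal{F}_2\subseteq\Pi(n,k_2)$ are non-trivial cross $t$-intersecting families maximizing $|\mathcal{F}_1||\mathcal{F}_2|$ (among all non-trivial cross $t$-intersecting pairs in $\Pi(n,k_1)\times\Pi(n,k_2)$), then $(\mathcal{F}_1,\mathcal{F}_2)$ is isomorphic to one of $(\mathcal{A}(k_1,k_2,t),\mathcal{B}(k_2,t))$, $(\mathcal{B}(k_1,t),\mathcal{A}(k_2,k_1,t))$, $(\mathcal{C}(k_1,t),\mathcal{D}(k_2,t))$, $(\mathcal{D}(k_1,t),\mathcal{C}(k_2,t))$.
   Context: All letters denote positive integers. $[n]=\{1,\ldots,n\}$. A partition is a set of pairwise disjoint nonempty sets (blocks); $|P|$ is its number of blocks and $\cup P$ the union of its blocks. $\Pi(n,k)$ is the set of all partitions of $[n]$ into $k$ blocks; $S(n,k)=|\Pi(n,k)|$ (Stirling number of the second kind). For partitions $F,G$, $F\cap G$ is the set of common blocks. For $s\geq1$, $[[s]]:=\{\{1\},\ldots,\{s\}\}$. $L(k,t):=(t+1)+(k-t+1)\log_2((t+1)(k-t+1))$. $\mathcal{F}\subseteq\Pi(n,k)$, $\mathcal{G}\subseteq\Pi(n,\ell)$ are cross $t$-intersecting if $|F\cap G|\geq t$ for all $F\in\mathcal{F},G\in\mathcal{G}$; they are non-trivial if the set of blocks belonging to every member of $\mathcal{F}\cup\mathcal{G}$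 has fewer than $t$ elements. Two pairs of families are isomorphic if one is obtained from the other by applying a single permutation of $[n]$ to all blocks. Constructions: for an $\ell$-partition $M$ (of a subset of $[n]$) and $X\subseteq M$ with $|X|=t$, put $\overline{\cup M}=[n]\setminus\cup M$ and $\mathcal{A}(k,X,M)=\{F\in\Pi(n,k):X\subseteq F,\ F\cap(M\setminus X)\neq\emptyset\}$, $\mathcal{B}(\ell,X,M)=\{F\in\Pi(n,\ell):X\subseteq F\}\cup\{(M\setminus\{B\})\cup\{B\cup\overline{\cup M}\}:B\in X\}$; $\mathcal{A}(k,\ell,t)=\mathcal{A}(k,[[t]],[[\ell]])$, $\mathcal{B}(\ell,t)=\mathcal{B}(\ell,[[t]],[[\ell]])$. For a $(t+1)$-partition $T$: $\mathcal{C}(k,T)=\{F\in\Pi(n,k):T\subseteq F\}$, $\mathcal{D}(\ell,T)=\{F\in\Pi(n,\ell):|T\cap F|\geq t\}$; $\mathcal{C}(k,t)=\mathcal{C}(k,[[t+1]])$, $\mathcal{D}(\ell,t)=\mathcal{D}(\ell,[[t+1]])$. *)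

(* Defs.v *)
From Stdlib Require Import Reals.
From mathcomp Require Import all_boot all_order all_fingroup.
Set Implicit Arguments. Unset Strict Implicit. Unset Printing Implicit Defensive.

(* The ground set [n] = {1..n} is represented by 'I_n = {0..n-1} (i <-> i+1). *)
Notation block n := {set 'I_n}.
Notation spart n := {set {set 'I_n}}.
Notation pfamily_of n := {set {set {set 'I_n}}}.

Definition is_kpart (n k : nat) (P : spart n) : bool :=
  partition P [set: 'I_n] && (#|P| == k).

Definition Pi (n k : nat) : pfamily_of n := [set P | is_kpart k P].

Definition sing (n s : nat) : spart n := [set [set i] | i : 'I_n & i < s].

Definition L (k t : nat) : R :=
  Rplus (INR (t + 1))
    (Rmult (INR (k - t + 1)) (Rdiv (ln (INR ((t + 1) * (k - t + 1)))) (ln (INR 2)))).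

Definition cross_tint (n t : nat) (F G : pfamily_of n) : Prop :=
  forall A B, A \in F -> B \in G -> t <= #|A :&: B|.

Definition common_blocks (n : nat) (F G : pfamily_of n) : {set block n} :=
  [set B | [forall P in F :|: G, B \in P]].

Definition nontrivial (n t : nat) (F G : pfamily_of n) : Prop :=
  #|common_blocks F G| < t.

Definition perm_part (n : nat) (s : {perm 'I_n}) (P : spart n) : spart n :=
  [set s @: (B : {set _}) | B in P].
Definition perm_fam (n : nat) (s : {perm 'I_n}) (F : pfamily_of n) : pfamily_of n :=
  [set perm_part s P | P in F].

Definition iso_pair (n : nat) (F1 F2 G1 G2 : pfamily_of n) : Prop :=
  exists s : {perm 'I_n}, perm_fam s G1 = F1 /\ perm_fam s G2 = F2.

Definition Afam (n k : nat) (X M : spart n) : pfamily_of n :=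
  [set F in Pi n k | (X \subset F) && (F :&: (M :\: X) != set0)].

Definition Bfam (n l : nat) (X M : spart n) : pfamily_of n :=
  [set F in Pi n l | X \subset F] :|:
  [set (M :\ B) :|: [set B :|: ~: cover M] | B in X].

Definition Cfam (n k : nat) (T : spart n) : pfamily_of n :=
  [set F in Pi n k | T \subset F].

Definition Dfam (n l t : nat) (T : spart n) : pfamily_of n :=
  [set F in Pi n l | t <= #|T :&: F|].

Arguments Afam : clear implicits.
Arguments Bfam : clear implicits.
Arguments Cfam : clear implicits.
Arguments Dfam : clear implicits.

Definition A3 (n k l t : nat) : pfamily_of n := Afam n k (sing n t) (sing n l).
Definition B2 (n l t : nat) : pfamily_of n := Bfam n l (sing n t) (sing n l).
Definition C2 (n k t : nat) : pfamily_of n := Cfam n k (sing n t.+1).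
Definition D2 (n l t : nat) : pfamily_of n := Dfam n l t (sing n t.+1).

(* Main.v *)
Require Import Defs.
From Stdlib Require Import Reals Lra.
From mathcomp Require Import all_boot all_order all_fingroup zify.
Set Implicit Arguments. Unset Strict Implicit. Unset Printing Implicit Defensive.

(** Write [S] for Stirling numbers and, for the pair of indices [(k, l)],
    [s' = S(n-t, l-t)], [p = S(n-t-1, k-t-1)], [q = S(n-t-2, k-t-2)].  At most
    [S(n-j, k-j)] partitions contain [j < k] given blocks, with equality for
    singletons, and [n >= 2 L] makes this bound drop by a factor
    [N ^ 2 = ((t+1)(k1-t+1)) ^ 2] each time [j] grows by one.

    If [Y] is not a [t]-cover of [H], then any member of [F] containing [Y] meets a
    fixed set of [l-t+1] blocks outside [Y].  Iterating up to the least size of a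
    [t]-cover bounds the product of the two families; it falls below the value
    [max(l-t, t+1) p s'] of the constructions unless one family, say [F], has a
    common [t]-set [X].  Call a block [b] heavy if [b |: X] is a [t]-cover of [H] used
    by [F].  There are at most [l-t] heavy blocks.  If some heavy block lies in all of
    [F], the pair is contained in (C, D); if there are [l-t] of them, it is contained
    in (A, B); otherwise the product is too small.  Maximality turns inclusion into
    equality, and comparing sizes forces the prescribed blocks to be singletons.

    The index [k = t+2] needs care because [p = 1] carries no information on block
    sizes: a one-element [F] is treated through its largest block, and the ties
    between non-isomorphic pairs of type (A, B) are beaten by (C, D), except in the
    excluded case [(3, 3)]. *)

(** [N] bounds the price of enlarging a cover by one block: the binomial that counts the [t]-subsets
    of the cover grows by a factor at most [t + 1], and branching inside a member of the other
    family costs a factor at most [k1 - t + 1]. A drop by [N ^ 2] pays this price and leaves a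
    factor [N] per level, which absorbs the lower order terms. These matter because (C, D) has size
    about [(t + 1) p s'] and (A, B) about [(l - t) p s'], and neither is larger for all parameters.

    Containment in a construction does not yet fix the isomorphism type, since the prescribed blocks
    may be large. A large block removes one more point from a Stirling number, and this at least
    halves it when its second index is at least 2. For [k = t + 2] the second index of [p] is 1, so
    enlarging blocks of [M] outside [X] need not cost anything; only the bound [(l - t) (s' + t)] on
    the product remains. For [k = l = t + 2] it reads [2 (s' + t)], to be compared with about
    [(t + 1) s' - t p'] for (C, D): smaller when [t > 1], larger when [t = 1], which is the case (3,
    3). *)

Ltac keep_arith := repeat match goal with H : ?A |- _ =>
  lazymatch A with
  | nat => fail
  | is_true (leq _ _) => fail
  | @eq nat _ _ => fail
  | _ => clear H
  end end.
Ltac nlia := keep_arith; lia.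
Ltac nnia := keep_arith; nia.

(** * Stirling numbers of the second kind *)

Fixpoint stir (m j : nat) : nat :=
  match m, j with
  | 0, 0 => 1
  | 0, _.+1 => 0
  | _.+1, 0 => 0
  | m'.+1, j'.+1 => j'.+1 * stir m' j'.+1 + stir m' j'
  end.

Lemma stirSS m j : stir m.+1 j.+1 = j.+1 * stir m j.+1 + stir m j.
Proof. by []. Qed.

Lemma stirS0 m : stir m.+1 0 = 0. Proof. by []. Qed.

Lemma stir_small m j : m < j -> stir m j = 0.
Proof.
elim: m j => [|m IH] [|j] // lt_mj.
by rewrite stirSS !IH ?muln0 // ltnW.
Qed.

Lemma stir_diag j : stir j j = 1.
Proof. by elim: j => [|j IH] //; rewrite stirSS IH stir_small // muln0. Qed.

Lemma stir1 m : stir m.+1 1 = 1.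
Proof. by elim: m => [|m IH] //; rewrite stirSS IH. Qed.

Lemma stir2 m : stir m.+1 2 = (2 ^ m).-1.
Proof.
elim: m => [|m IH] //; rewrite stirSS IH stir1.
have := expn_gt0 2 m; rewrite /= expnS; lia.
Qed.

Lemma stir_gt0 m j : 0 < j -> j <= m -> 0 < stir m j.
Proof.
case: j => // j _; elim: m => // m IH; rewrite ltnS leq_eqVlt => /orP[/eqP<-|lt].
  by rewrite stir_diag.
by rewrite stirSS addn_gt0 muln_gt0 IH.
Qed.

Lemma stir_mulS m j : j * stir m j <= stir m.+1 j.
Proof. by case: j => // j; rewrite stirSS leq_addr. Qed.

(** Each of the [u] additional points can join any of the [j >= c] existing blocks. *)
Lemma stir_mulX c m u j : c <= j -> c ^ u * stir m j <= stir (m + u) j.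
Proof.
move=> cj; elim: u => [|u IH]; first by rewrite mul1n addn0.
rewrite expnS -mulnA addnS; apply: leq_trans (stir_mulS _ _).
exact: leq_mul.
Qed.

Lemma leq_stir m m' j : 0 < j -> m <= m' -> stir m j <= stir m' j.
Proof.
move=> j0 /subnKC<-; have := stir_mulX m (m' - m) j0.
by rewrite exp1n mul1n.
Qed.

(* The ratio bound is inherited by both terms of the recurrence, because
   [j / (j-1)] decreases in [j]. *)
Lemma stir_ratio d j :
  j.+2 ^ d * stir (j.+1 + d) j.+1 <= j.+1 ^ d * stir (j.+2 + d) j.+2.
Proof.
elim: d j => [|d IHd] j; first by rewrite !addn0 !stir_diag.
elim: j => [|j IHj].
  rewrite -[1 + d.+1]/d.+2 -[2 + d.+1]/d.+3 stir1 exp1n mul1n muln1 stir2.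
  rewrite [2 ^ d.+2]expnS.
  by have := expn_gt0 2 d.+1; lia.
rewrite !addnS in IHj *; rewrite [stir (_.+1) j.+2]stirSS [stir (_.+1) j.+3]stirSS.
rewrite mulnDr [X in _ <= X]mulnDr leq_add //.
  by have := IHd j.+1; rewrite !expnS; set a := stir _ _; set b := stir _ _; nia.
have Hb : j.+3 ^ d.+1 * j.+1 ^ d.+1 <= j.+2 ^ d.+1 * j.+2 ^ d.+1.
  by rewrite -!expnMn leq_exp2r //; nia.
rewrite -(leq_pmul2l (m := j.+2 ^ d.+1)) ?expn_gt0 // mulnCA.
apply: leq_trans (_ : j.+3 ^ d.+1 * (j.+1 ^ d.+1 * stir (j.+2 + d).+1 j.+2) <= _).
  by rewrite leq_mul2l IHj orbT.
by rewrite !mulnA leq_mul2r Hb orbT.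
Qed.

(** * Partitions of a finite set counted by Stirling numbers *)

Section Parts.
Variable T : finType.
Implicit Types (D : {set T}) (P Q : {set {set T}}).

Definition parts D j := [set P | partition P D && (#|P| == j)].

(** The bijection behind the recurrence: a partition of [x |: D] in which [x] is not alone amounts
    to a partition of [D] with a marked block, the one that receives [x]. The pair carries the
    partition and the marked block. *)
Definition extend (x : T) (p : {set {set T}} * {set T}) :=
  (x |: p.2) |: (p.1 :\ p.2).
Definition contract (x : T) P :=
  ((pblock P x :\ x) |: (P :\ pblock P x), pblock P x :\ x).

Lemma extend_part x D Q B : x \notin D -> partition Q D -> B \in Q ->
  [/\ partition (extend x (Q, B)) (x |: D), #|extend x (Q, B)| = #|Q|,
      [set x] \notin extend x (Q, B) & contract x (extend x (Q, B)) = (Q, B)].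
Proof.
move=> xD pQ BQ; rewrite /extend /=.
have sBD := partitionS pQ BQ.
have xB : x \notin B by apply: contra xD; apply: subsetP.
have B0 := partition_neq0 pQ BQ.
have xBn : x |: B \notin Q :\ B.
  apply/negP => /setD1P[_ /(partitionS pQ)/subsetP/(_ x)].
  by rewrite setU11 (negbTE xD) => /(_ isT).
have pE : partition (x |: B |: Q :\ B) (x |: D).
  have -> : x |: D = (x |: B) :|: (D :\: B).
    apply/setP=> y; rewrite !inE; case: (boolP (y \in B)) => // yB.
      by rewrite (subsetP sBD) // orbT.
    by rewrite orbF.
  apply: partitionU1; first exact: partitionD1.
    by apply/set0Pn; exists x; rewrite setU11.
  rewrite disjoint_sym disjoints_subset; apply/subsetP=> y; rewrite !inE negb_or.
  by case/andP=> -> yD; rewrite andbT; apply: contraNneq xD => <-.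
have e1 : pblock (x |: B |: Q :\ B) x = x |: B.
  by apply: def_pblock; rewrite ?setU11 //; apply: partition_trivIset pE.
split=> //.
- by rewrite cardsU1 xBn (cardsD1 B Q) BQ.
- rewrite !inE negb_or; apply/andP; split.
    apply: contra B0 => /eqP e; apply/eqP/setP=> y; rewrite inE.
    apply/negP=> yB; have : y \in [set x] by rewrite e !inE yB orbT.
    by rewrite inE => /eqP yx; rewrite -yx yB in xB.
  rewrite negb_and; apply/orP; right; apply: contra xD => /(partitionS pQ)/subsetP.
  by apply; rewrite inE.
- rewrite /contract e1; have -> : (x |: B) :\ x = B.
    by rewrite setU1K.
  by rewrite setU1K // setD1K.
Qed.

Lemma contract_part x D P : x \notin D -> partition P (x |: D) -> [set x] \notin P ->
  [/\ partition (contract x P).1 D, #|(contract x P).1| = #|P|,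
      (contract x P).2 \in (contract x P).1 & extend x (contract x P) = P].
Proof.
move=> xD pP xP; rewrite /contract /=.
have xc : x \in cover P by rewrite (cover_partition pP) setU11.
set C := pblock P x.
have CP : C \in P by rewrite pblock_mem.
have xC : x \in C by rewrite mem_pblock.
have C0 : C :\ x != set0.
  apply: contra xP => /eqP e; suff <- : C = [set x] by [].
  by rewrite -(setD1K xC) e setU0.
have sC := partitionS pP CP.
have CnP : C :\ x \notin P :\ C.
  apply/negP=> /setD1P[ne CxP]; case/set0Pn: C0 => y yC.
  have yC' : y \in C by move: yC; rewrite inE => /andP[].
  have tP := partition_trivIset pP.
  by move: ne; rewrite -(def_pblock tP CxP yC) (def_pblock tP CP yC') eqxx.
have pQ : partition (C :\ x |: P :\ C) D.
  have -> : D = (C :\ x) :|: ((x |: D) :\: C).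
    apply/setP=> y; rewrite !inE; case: (eqVneq y x) => [->|yx] /=.
      by rewrite xC (negbTE xD).
    case: (boolP (y \in C)) => //= yC.
    by move: (subsetP sC _ yC); rewrite !inE (negbTE yx).
  apply: partitionU1 => //; first exact: partitionD1.
  rewrite disjoints_subset; apply/subsetP=> y; rewrite !inE => /andP[_ ->].
  by [].
split=> //.
- by rewrite cardsU1 CnP (cardsD1 C P) CP.
- by rewrite setU11.
- by rewrite /extend /= setD1K // setU1K // setD1K.
Qed.

Lemma parts_set0 j : #|parts set0 j| = stir 0 j.
Proof.
case: j => [|j].
  rewrite (_ : parts set0 0 = [set set0]) ?cards1 //.
  apply/setP=> P; rewrite !inE partition_set0 -cards_eq0.
  by rewrite andbb.
apply/eqP; rewrite cards_eq0 -subset0; apply/subsetP=> P.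
by rewrite !inE partition_set0 => /andP[/eqP->]; rewrite cards0.
Qed.

(** Fix a point [x]. Either [[set x]] is a block ([A1]), and deleting it leaves [j] blocks, or the
    partition arises by [extend] from [j + 1] blocks, one of them marked ([A2]). *)
Lemma card_parts D j : #|parts D j| = stir #|D| j.
Proof.
move eD: #|D| => m; elim: m => [|m IHm] in D j eD *.
  by move/eqP: eD; rewrite cards_eq0 => /eqP->; rewrite parts_set0.
have [x xD] : exists x, x \in D.
  by apply/set0Pn; rewrite -cards_eq0 eD.
have xD' : x \notin D :\ x by rewrite setD11.
have eD' : #|D :\ x| = m by move: eD; rewrite (cardsD1 x D) xD add1n => -[].
case: j => [|j].
  apply/eqP; rewrite stirS0 cards_eq0 -subset0; apply/subsetP=> P.
  rewrite !inE cards_eq0 => /andP[pP /eqP eP]; move: (cover_partition pP).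
  by rewrite eP /cover big_set0 => e; rewrite -e inE in xD.
rewrite stirSS -!(IHm _ _ eD').
pose A1 := [set [set x] |: Q | Q in parts (D :\ x) j].
pose Z := [set p : {set {set T}} * {set T} | (p.1 \in parts (D :\ x) j.+1) && (p.2 \in p.1)].
pose A2 := [set extend x p | p in Z].
have ZP p : p \in Z -> [/\ partition (extend x p) D, #|extend x p| = j.+1,
      [set x] \notin extend x p & contract x (extend x p) = p].
  case: p => Q B; rewrite [(Q, B) \in Z]inE /= [Q \in _]inE => /andP[/andP[pQ /eqP cQ] BQ].
  have [h1 h2 h3 h4] := extend_part xD' pQ BQ.
  by split; rewrite ?h2 //; rewrite -(setD1K xD).
have xnQ Q : Q \in parts (D :\ x) j -> [set x] \notin Q.
  rewrite inE => /andP[pQ _]; apply/negP=> /(partitionS pQ)/subsetP/(_ x).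
  by rewrite inE eqxx => /(_ isT); rewrite setD11.
have eA : parts D j.+1 = A2 :|: A1.
  apply/setP=> P; rewrite in_setU; apply/idP/orP => [|[|]].
  - rewrite inE => /andP[pP /eqP cP].
    have [xP|xP] := boolP ([set x] \in P); [right|left]; apply/imsetP.
      exists (P :\ [set x]); last by rewrite setD1K.
      rewrite inE partitionD1 //=; move: cP.
      by rewrite (cardsD1 [set x]) xP add1n => -[->].
    rewrite -(setD1K xD) in pP; have [h1 h2 h3 h4] := contract_part xD' pP xP.
    by exists (contract x P) => //; rewrite inE h3 inE h1 h2 cP eqxx.
  - by case/imsetP=> p /ZP[pE cE _ _] ->; rewrite inE pE cE /=.
  - case/imsetP=> Q QP ->; move: (QP); rewrite inE => /andP[pQ /eqP cQ].
    rewrite inE cardsU1 xnQ // cQ eqxx andbT -(setD1K xD).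
    apply: partitionU1 => //; first by apply/set0Pn; exists x; rewrite inE.
    by rewrite disjoints1 setD11.
rewrite eA cardsU (_ : A2 :&: A1 = set0) ?cards0 ?subn0.
  congr (_ + _).
    rewrite card_in_imset; last first.
      by apply: (@can_in_inj _ _ _ _ (contract x)) => p /ZP[].
    rewrite -sum1dep_card.
    rewrite -(pair_big_dep (mem (parts (D :\ x) j.+1)) (fun Q B => B \in Q)
               (fun _ _ => 1)) /=.
    rewrite (eq_bigr (fun _ => j.+1)).
      by rewrite sum_nat_const mulnC.
    by move=> Q; rewrite inE sum1_card => /andP[_ /eqP].
  rewrite card_in_imset // => Q1 Q2 h1 h2 e.
  by rewrite -(setU1K (xnQ _ h1)) e setU1K // xnQ.
apply/setP=> P; rewrite !inE; apply/negP=> /andP[/imsetP[p /ZP[_ _ + _] ->]].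
by move=> + /imsetP[Q _ e]; rewrite e setU11.
Qed.

End Parts.

(** * Partitions through prescribed blocks *)

Lemma partition_setD (T : finType) (P Y : {set {set T}}) (D : {set T}) :
  partition P D -> Y \subset P -> partition (P :\: Y) (D :\: cover Y).
Proof.
move=> /and3P[/eqP cP tP P0] sYP; apply/and3P; split.
- apply/eqP/setP=> x; rewrite inE -cP; apply/bigcupP/andP => [[B /setDP[BP BY] xB]|].
    split; last by apply/bigcupP; exists B.
    apply/bigcupP=> -[C CY xC]; case/negP: BY.
    by rewrite -(def_pblock tP BP xB) (def_pblock tP (subsetP sYP _ CY) xC).
  case=> xY /bigcupP[B BP xB]; exists B => //; rewrite inE BP andbT.
  by apply: contra xY => BY; apply/bigcupP; exists B.
- exact: trivIsetD.
- by rewrite inE (negbTE P0) andbF.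
Qed.

Lemma partition_setU (T : finType) (Q Y : {set {set T}}) (D : {set T}) :
  partition Q D -> trivIset Y -> set0 \notin Y -> [disjoint D & cover Y] ->
  partition (Q :|: Y) (D :|: cover Y).
Proof.
move=> /and3P[/eqP cQ tQ Q0] tY Y0 dis; apply/and3P; split.
- by rewrite /cover bigcup_setU -/(cover Q) cQ.
- by rewrite trivIsetU // cQ.
- by rewrite inE negb_or Q0.
Qed.

Section Counting.
Variable n : nat.
Implicit Types (P Q Y Z : spart n) (F H : pfamily_of n).

Lemma mem_Cfam k Y P :
  (P \in Cfam n k Y) = [&& partition P setT, #|P| == k & Y \subset P].
Proof. by rewrite !inE /is_kpart andbA. Qed.

(** Deleting [Y] is a bijection onto the partitions of the complement of [cover Y] into the
    remaining number of blocks. *)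
Lemma card_Cfam k Y : trivIset Y -> set0 \notin Y -> #|Y| <= k ->
  #|Cfam n k Y| = stir (n - #|cover Y|) (k - #|Y|).
Proof.
move=> tY Y0 leYk.
have -> : n - #|cover Y| = #|~: cover Y| by rewrite [#|~: _|]cardsCs setCK card_ord.
rewrite -card_parts.
have disQ Q j : Q \in parts (~: cover Y) j -> [disjoint Q & Y].
  rewrite inE => /andP[pQ _]; rewrite disjoints_subset; apply/subsetP=> B BQ.
  rewrite inE; apply/negP=> BY; case/set0Pn: (partition_neq0 pQ BQ) => x xB.
  move/subsetP/(_ x xB): (partitionS pQ BQ); rewrite inE => /bigcupP; case.
  by exists B.
have inj : {in parts (~: cover Y) (k - #|Y|) &, injective (fun Q => Q :|: Y)}.
  move=> Q1 Q2 /disQ d1 /disQ d2 /(congr1 (fun Z => Z :\: Y)).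
  by rewrite !setDUl setDv !setU0 (setDidPl d1) (setDidPl d2).
rewrite -(card_in_imset inj); apply: eq_card => P; rewrite mem_Cfam.
apply/and3P/imsetP => [[pP /eqP cP sYP]|[Q QP ->]].
  exists (P :\: Y); last first.
    apply/setP=> B; rewrite !inE; case: (boolP (B \in Y)) => [/(subsetP sYP)->|] //=.
    by rewrite orbF.
  by rewrite inE -setTD partition_setD //= cardsD (setIidPr sYP) cP eqxx.
have := disQ _ _ QP; move: QP; rewrite inE => /andP[pQ /eqP cQ] dis.
rewrite subsetUr cardsU (disjoint_setI0 dis) cards0 cQ subn0 subnK // eqxx; split=> //.
have -> : [set: 'I_n] = ~: cover Y :|: cover Y by rewrite setUC setUCr.
apply: partition_setU => //.
by rewrite disjoints_subset subxx.
Qed.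

Lemma card_cover Y : trivIset Y -> #|cover Y| = \sum_(B in Y) #|B|.
Proof. by rewrite /trivIset => /eqP. Qed.

Lemma leq_card_cover_block Y c : trivIset Y -> set0 \notin Y -> c \in Y ->
  #|Y|.-1 + #|c| <= #|cover Y|.
Proof.
move=> tY Y0 cY; rewrite card_cover // (bigD1 c) //= addnC leq_add2l.
have -> : #|Y|.-1 = \sum_(B in Y | B != c) 1.
  rewrite sum1dep_card (cardsD1 c Y) cY /=; apply: eq_card => B.
  by rewrite !inE andbC.
apply: leq_sum => B /andP[BY _]; rewrite card_gt0.
by apply: contraNneq Y0 => <-.
Qed.

Lemma leq_card_cover_set Y : trivIset Y -> set0 \notin Y -> #|Y| <= #|cover Y|.
Proof.
move=> tY Y0; rewrite card_cover // -sum1_card.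
by apply: leq_sum => B BY; rewrite card_gt0; apply: contraNneq Y0 => <-.
Qed.

Lemma sub_partition_trivIset P Y : partition P setT -> Y \subset P ->
  trivIset Y /\ set0 \notin Y.
Proof.
move=> pP sYP; split; first exact: trivIsetS (partition_trivIset pP).
by apply/negP=> /(subsetP sYP); rewrite (partition0 pP).
Qed.

(** The bound on the cover is requested only for an extendable [Y]; otherwise the family is empty.
    The strict inequality [#|Y| < k] keeps the second index positive, without which [stir] is not
    monotone. *)
Lemma card_Cfam_leq k Y u : #|Y| < k ->
  (trivIset Y -> set0 \notin Y -> u <= #|cover Y|) ->
  #|Cfam n k Y| <= stir (n - u) (k - #|Y|).
Proof.
move=> ltYk leu; have [->|[P]] := set_0Vmem (Cfam n k Y); first by rewrite cards0.
rewrite mem_Cfam => /and3P[pP _ sYP]; have [tY Y0] := sub_partition_trivIset pP sYP.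
rewrite card_Cfam // ?(ltnW ltYk) //; apply: leq_stir; first by rewrite subn_gt0.
by rewrite leq_sub2l // leu.
Qed.

Lemma card_Cfam_le k Y : #|Y| < k -> #|Cfam n k Y| <= stir (n - #|Y|) (k - #|Y|).
Proof. by move/card_Cfam_leq; apply; apply: leq_card_cover_set. Qed.

(** A block with two points lowers the first index by one more unit; this is the loss that later
    forces singletons. *)
Lemma card_Cfam_block k Y c : #|Y| < k -> c \in Y -> 1 < #|c| ->
  #|Cfam n k Y| <= stir (n - #|Y|.+1) (k - #|Y|).
Proof.
move=> ltYk cY c1; apply: card_Cfam_leq => // tY Y0.
apply: leq_trans (leq_card_cover_block tY Y0 cY).
by have := cardsD1 c Y; rewrite cY; lia.
Qed.

Definition singletons Y := [forall B in Y, #|B| == 1].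

Lemma singletonsP Y :
  reflect (forall B, B \in Y -> exists x, B = [set x]) (singletons Y).
Proof.
apply: (iffP forall_inP) => h B /h; first by move/cards1P.
by case=> x ->; rewrite cards1.
Qed.

Lemma singletons_trivIset Y : singletons Y ->
  [/\ trivIset Y, set0 \notin Y & #|cover Y| = #|Y|].
Proof.
move=> /singletonsP sY.
have tY : trivIset Y.
  apply/trivIsetP=> A B /sY[x ->] /sY[y ->] ne; rewrite disjoints1 inE.
  by apply: contraNneq ne => ->.
split=> //; first by apply/negP=> /sY[x /setP/(_ x)]; rewrite !inE eqxx.
rewrite card_cover // -sum1_card; apply: eq_bigr => B /sY[x ->].
by rewrite cards1.
Qed.

Lemma card_Cfam_singletons k Y : singletons Y -> #|Y| <= k ->
  #|Cfam n k Y| = stir (n - #|Y|) (k - #|Y|).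
Proof. by case/singletons_trivIset=> tY Y0 eY leYk; rewrite card_Cfam // eY. Qed.

Lemma singletonsS Y Z : Y \subset Z -> singletons Z -> singletons Y.
Proof.
move=> /subsetP sYZ /forall_inP sZ; apply/forall_inP=> B /sYZ; exact: sZ.
Qed.

End Counting.

Lemma leq_card_sum_union (I J : finType) (A : {set J}) (I0 : {set I})
    (B : I -> {set J}) :
  (forall x, x \in A -> exists2 i, i \in I0 & x \in B i) ->
  #|A| <= \sum_(i in I0) #|B i|.
Proof.
move=> cov; apply: leq_trans (_ : #|\bigcup_(i in I0) B i| <= _).
  by apply/subset_leq_card/subsetP=> x /cov[i iI xB]; apply/bigcupP; exists i.
elim/big_ind2: _ => [|S1 m1 S2 m2 h1 h2|//]; first by rewrite cards0.
by apply: leq_trans (leq_card_setU _ _) _; rewrite leq_add.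
Qed.

Lemma leq_card_union (I J : finType) (A : {set J}) (I0 : {set I})
    (B : I -> {set J}) c :
  (forall x, x \in A -> exists2 i, i \in I0 & x \in B i) ->
  (forall i, i \in I0 -> #|B i| <= c) -> #|A| <= #|I0| * c.
Proof.
move=> cov leB; rewrite -sum_nat_const.
by apply: leq_trans (leq_card_sum_union cov) _; apply: leq_sum.
Qed.

(** * The threshold on [n] *)

Lemma INR_expn a b : INR (a ^ b) = pow (INR a) b.
Proof. by elim: b => [|b IH] //=; rewrite expnS mult_INR IH. Qed.

Lemma leq_of_ln a b : 0 < a -> 0 < b -> Rle (ln (INR a)) (ln (INR b)) -> a <= b.
Proof.
move=> a0 b0 le_ln; apply/leP/INR_le.
have pa : Rlt 0 (INR a) by apply: lt_0_INR; apply/ltP.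
have pb : Rlt 0 (INR b) by apply: lt_0_INR; apply/ltP.
case: (Rle_lt_dec (INR a) (INR b)) => // lt_ba.
by have := ln_increasing _ _ pb lt_ba; lra.
Qed.

(** Multiplying [n >= 2 L] by [ln 2] and exponentiating; all further estimates stay in the natural
    numbers. *)
Lemma threshold_nat n t k : Rle (Rmult (INR 2) (L k t)) (INR n) ->
  4 ^ (t + 1) * ((t + 1) * (k - t + 1)) ^ (2 * (k - t + 1)) <= 2 ^ n.
Proof.
set N := (t + 1) * (k - t + 1); set e := k - t + 1 => le_n.
have N0 : 0 < N by rewrite /N !addn1.
have pN : Rlt 0 (INR N) by apply: lt_0_INR; apply/ltP.
have p2 : Rlt 0 (INR 2) by apply: lt_0_INR; apply/ltP.
have ln2 : Rlt 0 (ln (INR 2)) by rewrite -ln_1; apply: ln_increasing; simpl; lra.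
apply: leq_of_ln; rewrite ?muln_gt0 ?expn_gt0 ?N0 //.
rewrite (_ : 4 ^ (t + 1) = 2 ^ (2 * (t + 1))); last by rewrite expnM.
rewrite mult_INR !INR_expn ln_mult; try exact: pow_lt.
rewrite !ln_pow // (mult_INR 2 (t + 1)) (mult_INR 2 e).
move: le_n; rewrite /L -/e -/N; move: (ln (INR 2)) ln2 (ln (INR N)) => a a0 b le_n.
have := Rmult_le_compat_r a _ _ (Rlt_le _ _ a0) le_n.
have -> : Rmult (Rmult (INR 2) (Rplus (INR (t + 1)) (Rmult (INR e) (Rdiv b a)))) a =
  Rplus (Rmult (Rmult (INR 2) (INR (t + 1))) a) (Rmult (Rmult (INR 2) (INR e)) b).
  by field; lra.
by [].
Qed.

(** The terms of degree at most 2 in the binomial expansion of [(1 + 1/q) ^ m], with denominators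
    cleared. *)
Lemma bernoulli2 q m :
  (2 * q ^ 2 + 2 * m * q + m * m.-1) * q ^ m <= 2 * q ^ 2 * q.+1 ^ m.
Proof.
elim: m => [|m IH]; first by rewrite !muln0 !mul0n !addn0.
rewrite [q.+1 ^ _]expnS mulnCA.
apply: leq_trans (_ : q.+1 * ((2 * q ^ 2 + 2 * m * q + m * m.-1) * q ^ m) <= _);
  last by rewrite leq_mul2l IH orbT.
rewrite [q ^ m.+1]expnS mulnA [X in _ <= X]mulnA leq_mul2r; apply/orP; right.
by rewrite -mulnn; case: m {IH} => [|m] /=; nia.
Qed.

Lemma two_pow_ratio q : 0 < q -> 2 * q ^ q <= q.+1 ^ q.
Proof.
move=> q0; have h := bernoulli2 q q.
rewrite -(leq_pmul2l (m := 2 * q ^ 2)) ?muln_gt0 ?expn_gt0 ?q0 //.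
apply: leq_trans h; rewrite mulnA leq_mul2r; apply/orP; right.
by rewrite -mulnn; nia.
Qed.

(** For [m = q] the three terms add up to [5/2 - 1/(2q)], which is at least [9/4] from [q = 2]
    on. *)
Lemma nine_quarters_ratio q : 1 < q -> 9 * q ^ q <= 4 * q.+1 ^ q.
Proof.
move=> q1; have h := bernoulli2 q q.
rewrite -(leq_pmul2l (m := q ^ 2)) ?expn_gt0 ?(ltnW q1) //.
apply: leq_trans (_ : 2 * (2 * q ^ 2 * q.+1 ^ q) <= _); last by nia.
apply: leq_trans (_ : 2 * ((2 * q ^ 2 + 2 * q * q + q * q.-1) * q ^ q) <= _).
  rewrite !mulnA leq_mul2r; apply/orP; right; rewrite -mulnn; nia.
by rewrite leq_mul2l.
Qed.

(** * Numerical consequences of the threshold, with [K] standing for [k1 - t] *)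

Section Numeric.
Variables n t K : nat.
Hypotheses (t0 : 0 < t) (K2 : 2 <= K).
Let N := (t + 1) * (K + 1).
Hypothesis big_n : 4 ^ (t + 1) * N ^ (2 * (K + 1)) <= 2 ^ n.

Let N6 : 6 <= N. Proof. rewrite /N; nia. Qed.
Let N0 : 0 < N. Proof. lia. Qed.

Lemma ground_large : K + t < n.
Proof.
rewrite -(ltn_exp2l (m := 2)) //; apply: leq_trans big_n.
rewrite addnC expnD (_ : 4 ^ (t + 1) = 2 ^ t * 2 ^ (t + 2)); last first.
  by rewrite -expnD -(expnM 2 2); congr (_ ^ _); lia.
rewrite -mulnA ltn_pmul2l ?expn_gt0 //.
apply: leq_trans (_ : N ^ (2 * (K + 1)) <= _); last by rewrite leq_pmull ?expn_gt0.
apply: leq_trans (_ : 2 ^ (2 * (K + 1)) <= _); last by rewrite leq_exp2r; lia.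
by rewrite ltn_exp2l //; lia.
Qed.

(** The threshold in terms of [n - (K + t) = n - k1], the exponent that occurs in the ratio of
    Stirling numbers. *)
Lemma pow_ground : 2 ^ (t + 2) * N ^ (2 * (K + 1)) <= 2 ^ (n - (K + t)) * 2 ^ K.
Proof.
rewrite -(leq_pmul2l (m := 2 ^ t)) ?expn_gt0 // -expnD.
have -> : 2 ^ t * 2 ^ (n - (K + t) + K) = 2 ^ n.
  by rewrite -expnD; congr (_ ^ _); have := ground_large; lia.
apply: leq_trans big_n; rewrite mulnA -expnD.
by rewrite (_ : 4 = 2 ^ 2) // -expnM leq_mul2r leq_exp2l //; apply/orP; right; lia.
Qed.

Lemma pow_gap : N ^ 4 <= 2 ^ (n - (K + t)).
Proof.
rewrite -(leq_pmul2r (m := 2 ^ K)) ?expn_gt0 //; apply: leq_trans pow_ground.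
apply: leq_trans (_ : N ^ 4 * N ^ K <= _).
  by rewrite leq_mul2l leq_exp2r ?orbT; lia.
rewrite -expnD; apply: leq_trans (_ : N ^ (2 * (K + 1)) <= _).
  by rewrite leq_exp2l; lia.
by rewrite leq_pmull ?expn_gt0.
Qed.

Lemma gap_large : 10 <= n - (K + t).
Proof.
rewrite -(leq_exp2l (m := 2)) //; apply: leq_trans pow_gap.
by apply: leq_trans (_ : 6 ^ 4 <= _) => //; rewrite leq_exp2r.
Qed.

(** Put [q = K - 1]. For [K <= 4] one has [2 ^ K <= N ^ 4], so the threshold gives
    [N ^ (2 q) <= 2 ^ d]; as [(K / q) ^ q >= 2], the [q]-th power of the claim follows. For larger
    [K] the factor [2 ^ K] is too expensive and the constant 2 is replaced by [9/4]. *)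
Lemma pow_ratio_top : N ^ 2 * K.-1 ^ (n - (K + t)) <= K ^ (n - (K + t)).
Proof.
have := pow_ground; set d := n - (K + t); set q := K.-1 => hp.
have eK : K = q.+1 by rewrite /q; lia.
have q0 : 0 < q by lia.
have [K4|K5] := leqP K 4.
  have hN : N ^ (2 * q) <= 2 ^ d.
    rewrite -(leq_pmul2r (m := 2 ^ K)) ?expn_gt0 //; apply: leq_trans hp.
    apply: leq_trans (_ : N ^ (2 * q) * N ^ 4 <= _).
      rewrite leq_mul2l; apply/orP; right; apply: leq_trans (_ : 2 ^ 4 <= _).
        by rewrite leq_exp2l.
      by rewrite leq_exp2r //; lia.
    rewrite -expnD (_ : 2 * q + 4 = 2 * (K + 1)); last by lia.
    by rewrite leq_pmull ?expn_gt0.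
  rewrite -(@leq_exp2r _ _ q) // expnMn -!expnM [d * q]mulnC {1}eK.
  apply: leq_trans (_ : 2 ^ d * q ^ (q * d) <= _); first by rewrite leq_mul2r hN orbT.
  by rewrite !expnM -expnMn leq_exp2r ?eK ?two_pow_ratio //; have := gap_large; lia.
(* The exponents 7 and 6 come from [9/4 >= 2 ^ (7/6)], that is [9 ^ 6 >= 2 ^ 7 * 4 ^ 6]. Now
   [N >= 12], so [2 ^ 7 <= N ^ 2] takes care of [2 ^ (7 K)]. *)
have hN : N ^ (12 * q) <= 2 ^ (7 * d).
  rewrite -(leq_pmul2r (m := 2 ^ (7 * K))) ?expn_gt0 //.
  apply: leq_trans (_ : (2 ^ (t + 2) * N ^ (2 * (K + 1))) ^ 7 <= _); last first.
    by rewrite [7 * d]mulnC [7 * K]mulnC (expnM 2 d) (expnM 2 K) -expnMn leq_exp2r.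
  apply: leq_trans (_ : N ^ (12 * q) * N ^ (2 * K) <= _).
    rewrite leq_mul2l; apply/orP; right; rewrite !expnM leq_exp2r; last by lia.
    by apply: leq_trans (_ : 12 ^ 2 <= _) => //; rewrite leq_exp2r // /N; nia.
  rewrite -expnD expnMn -!expnM; apply: leq_trans (_ : N ^ (2 * (K + 1) * 7) <= _).
    by rewrite leq_exp2l; lia.
  by rewrite leq_pmull ?expn_gt0.
have e0 : 0 < 6 * q by lia.
have d0 : 0 < 6 * d by have := gap_large; lia.
rewrite -(@leq_exp2r _ _ (6 * q)) // expnMn -!expnM.
have -> : 2 * (6 * q) = 12 * q by lia.
have -> : d * (6 * q) = q * (6 * d) by lia.
apply: leq_trans (_ : 2 ^ (7 * d) * q ^ (q * (6 * d)) <= _); first by rewrite leq_mul2r hN orbT.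
rewrite -(leq_pmul2l (m := 4 ^ (6 * d))) ?expn_gt0 //.
have h1 : 9 ^ (6 * d) * q ^ (q * (6 * d)) <= 4 ^ (6 * d) * K ^ (q * (6 * d)).
  by rewrite !(expnM _ q) -!expnMn leq_exp2r // eK nine_quarters_ratio //; lia.
apply: leq_trans h1; rewrite mulnA leq_mul2r; apply/orP; right.
rewrite !(expnM _ _ d) -expnMn leq_exp2r; last by lia.
lia.
Qed.

(** The quotient [(q + 1) / q] decreases in [q], so the case [q = K - 1] is the worst one. *)
Lemma pow_ratio q : 0 < q -> q < K ->
  N ^ 2 * q ^ (n - (K + t)) <= q.+1 ^ (n - (K + t)).
Proof.
move=> q0 ltqK; have := pow_ratio_top; set d := n - (K + t) => top.
have d0 : 0 < d by rewrite subn_gt0 ground_large.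
have eK : K = K.-1.+1 by lia.
have cross : (q * K) ^ d <= (q.+1 * K.-1) ^ d.
  by rewrite leq_exp2r // {1}eK mulnS mulSn leq_add2r; lia.
rewrite -(leq_pmul2r (m := K.-1 ^ d)) -?expnMn; last by rewrite expn_gt0; lia.
apply: leq_trans cross; rewrite expnMn; move: top; move: (q ^ d) (K.-1 ^ d) (K ^ d).
by move=> x y z; rewrite mulnAC => h; rewrite [x * z]mulnC leq_mul2r h orbT.
Qed.

(** By [stir_ratio] the quotient of the Stirling numbers is at least that of [(k - s) ^ (n - k)] and
    [(k - s - 1) ^ (n - k)]. The base satisfies [k - s <= K] because [t <= s], and the exponent is
    at least that of [pow_ratio]. *)
Lemma stir_step k s : t <= s -> s + 2 <= k -> k <= K + t ->
  N ^ 2 * stir (n - s.+1) (k - s.+1) <= stir (n - s) (k - s).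
Proof.
move=> ts sk kK; have gn := ground_large.
have := stir_ratio (n - k) (k - s - 2).
have -> : (k - s - 2).+1 + (n - k) = n - s.+1 by lia.
have -> : (k - s - 2).+2 + (n - k) = n - s by lia.
have -> : (k - s - 2).+2 = k - s by lia.
have -> : (k - s - 2).+1 = k - s.+1 by lia.
have pr : N ^ 2 * (k - s.+1) ^ (n - k) <= (k - s) ^ (n - k).
  have := @pow_ratio (k - s.+1); rewrite (_ : (k - s.+1).+1 = k - s); last by lia.
  have q0 : 0 < k - s.+1 by lia.
  have qK : k - s <= K by lia.
  move=> /(_ q0 qK) h.
  rewrite (_ : n - k = n - (K + t) + (K + t - k)); last by lia.
  rewrite !expnD mulnA leq_mul //; case: (posnP (K + t - k)) => [->|e0] //.
  by rewrite leq_exp2r //; lia.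
move=> h; rewrite -(leq_pmul2l (m := (k - s.+1) ^ (n - k))); last first.
  by rewrite expn_gt0; lia.
apply: leq_trans h; rewrite mulnCA mulnA leq_mul2r.
by rewrite pr orbT.
Qed.

(** With two blocks left the count is a power of 2 minus one, and the gain is [N ^ 4] instead of
    [N ^ 2]. This surplus settles the indices [t + 2] and [t + 3], where too few levels are
    available. *)
Lemma stir_two_large k : k <= K + t -> N ^ 4 <= stir (n - k + 2) 2.
Proof.
move=> kK; rewrite addn2 stir2 [2 ^ _]expnS.
have h : N ^ 4 <= 2 ^ (n - k).
  by apply: leq_trans pow_gap _; rewrite leq_exp2l //; lia.
have x0 : 0 < 2 ^ (n - k) by rewrite expn_gt0.
by move: (2 ^ (n - k)) h x0 => x; lia.
Qed.

Lemma pow_ground6 : 2 ^ (2 * t + 2) * N ^ 6 <= 2 ^ n.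
Proof.
apply: leq_trans big_n; rewrite (_ : 4 = 2 ^ 2) // -expnM.
by rewrite (_ : 2 * (t + 1) = 2 * t + 2) ?leq_mul2l ?leq_exp2l; lia.
Qed.

End Numeric.

(* The subtracted power makes the recurrence [g' <= 3/2 g + 1] telescope. *)
Lemma stir_ratio_upper d j :
  2 ^ d * stir (j.+3 + d) j.+3 + 2 ^ d.+1 * stir (j.+2 + d) j.+2
    <= 3 ^ d.+1 * stir (j.+2 + d) j.+2.
Proof.
elim: d => [|d IH]; first by rewrite !addn0 !stir_diag.
rewrite !addnS [stir _.+1 j.+3]stirSS -[j.+3 + d]/(j.+2 + d).+1 in IH *.
have := stir_mulS (j.+2 + d) j.+2.
have le23 : 2 ^ d <= 3 ^ d by case: d {IH} => // d; rewrite leq_exp2r.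
move: IH le23; rewrite !expnS.
move: (stir _ j.+3) (stir (j.+2 + d) _) (stir _.+1 j.+2) (2 ^ d) (3 ^ d).
move=> a b c x y IH xy h.
have h3 : 2 * j.+3 * b <= 3 * c by nia.
have h4 : x * a <= (3 * y - 2 * x) * b by nia.
have h5 : (3 * y - 2 * x) * (2 * j.+3 * b) <= (3 * y - 2 * x) * (3 * c).
  by rewrite leq_mul2l h3 orbT.
have h6 : 2 * j.+3 * (x * a) <= 2 * j.+3 * ((3 * y - 2 * x) * b).
  by rewrite leq_mul2l h4 orbT.
have : 2 * j.+3 * (x * a) + 6 * (x * c) <= 9 * (y * c).
  have e : (3 * y - 2 * x) * (3 * c) + 6 * (x * c) = 9 * (y * c) by nia.
  by rewrite -e leq_add2r; apply: leq_trans h6 _; rewrite mulnCA.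
lia.
Qed.

(** * [t]-covers and branching *)

Lemma exists_subset (T : finType) (A : {set T}) m :
  m <= #|A| -> exists2 W : {set T}, W \subset A & #|W| = m.
Proof.
move=> leA; have : 0 < #|[set W : {set T} | W \subset A & #|W| == m]|.
  by rewrite cards_draws bin_gt0.
by rewrite card_gt0 => /set0Pn[W]; rewrite inE => /andP[sW /eqP]; exists W.
Qed.

Section Covers.
Variables n t : nat.
Implicit Types (P Q G T X Y Z W : spart n) (F H : pfamily_of n).

Definition through F Y : pfamily_of n := [set P in F | Y \subset P].
Definition tcover H T := [forall G in H, t <= #|T :&: G|].

Lemma tcoverP H T :
  reflect (forall G, G \in H -> t <= #|T :&: G|) (tcover H T).
Proof. exact: forall_inP. Qed.

Lemma tcoverPn H T : ~~ tcover H T -> exists2 G, G \in H & #|T :&: G| < t.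
Proof. by move/forall_inPn=> [G GH]; rewrite -ltnNge; exists G. Qed.

Lemma through_Cfam k F Y : F \subset Pi n k -> through F Y \subset Cfam n k Y.
Proof.
move=> sF; apply/subsetP=> P; rewrite [P \in through _ _]inE => /andP[PF sYP].
by rewrite inE (subsetP sF) //.
Qed.

Lemma card_through_le k F Y : F \subset Pi n k -> #|Y| < k ->
  #|through F Y| <= stir (n - #|Y|) (k - #|Y|).
Proof.
move=> sF lt; apply: leq_trans (subset_leq_card (through_Cfam Y sF)) _.
exact: card_Cfam_le.
Qed.

Lemma Pi_card k F P : F \subset Pi n k -> P \in F -> #|P| = k.
Proof. by move=> /subsetP sF /sF; rewrite inE => /andP[_ /eqP]. Qed.

Lemma Pi_partition k F P : F \subset Pi n k -> P \in F -> partition P setT.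
Proof. by move=> /subsetP sF /sF; rewrite inE => /andP[]. Qed.

(** Deleting [l - t + 1] blocks from [G] leaves only [t - 1], so no member of [F] can avoid all of
    them. Since [Y] contains fewer than [t] blocks of [G], they can be chosen outside [Y]. *)
Lemma branch l F G Y : t <= l -> #|G| = l ->
  (forall P, P \in F -> t <= #|P :&: G|) -> #|Y :&: G| < t ->
  exists W, [/\ W \subset G :\: Y, #|W| = l - t + 1
    & forall P, P \in F -> exists2 w, w \in W & w \in P].
Proof.
move=> tl cG FG YG; have := @exists_subset _ (G :\: Y) (l - t + 1).
case=> [|W sW cW].
  by rewrite cardsD cG setIC; lia.
exists W; split=> // P PF; apply/exists_inP; apply: contraLR (FG _ PF).
move=> /exists_inPn noW; rewrite -ltnNge.
have : #|P :&: G| <= #|G :\: W|.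
  apply/subset_leq_card/subsetP=> B /setIP[BP BG]; rewrite inE BG andbT.
  by apply: contraL BP => /noW.
have sWG : W \subset G by apply: subset_trans sW (subsetDl _ _).
by have := subset_leq_card sWG; rewrite cardsD (setIidPr sWG) cG cW; lia.
Qed.

Lemma card_cover_le H T c : tcover H T ->
  (forall Z, Z \subset T -> #|Z| = t -> #|through H Z| <= c) ->
  #|H| <= 'C(#|T|, t) * c.
Proof.
move=> /tcoverP cT leZ; rewrite -cards_draws.
apply: (leq_card_union (B := through H)) => [G GH|Z].
  have [Z sZ cZ] := exists_subset (cT _ GH).
  exists Z; rewrite inE.
    by rewrite (subset_trans sZ (subsetIl _ _)) cZ eqxx.
  by rewrite GH (subset_trans sZ (subsetIr _ _)).
by rewrite inE => /andP[sZ /eqP]; apply: leZ.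
Qed.

Lemma min_tcover H T0 : tcover H T0 -> exists T,
  [/\ tcover H T, #|T| <= #|T0| & forall T', tcover H T' -> #|T| <= #|T'|].
Proof.
move=> c0; case: (arg_minnP (fun T : spart n => #|T|) c0) => T cT minT.
by exists T; split=> //; apply: minT.
Qed.

Lemma leq_tcover H T : H != set0 -> tcover H T -> t <= #|T|.
Proof.
case/set0Pn=> G GH /tcoverP/(_ _ GH)/leq_trans; apply.
exact/subset_leq_card/subsetIl.
Qed.

Lemma tcover_subset H Z G : #|Z| = t -> tcover H Z -> G \in H -> Z \subset G.
Proof.
move=> cZ /tcoverP cov /cov tG.
by apply/setIidPl/eqP; rewrite eqEcard subsetIl cZ.
Qed.

Section Pair.
Variables (k l : nat) (F H : pfamily_of n).
Hypotheses (tk : t.+2 <= k) (tl : t.+2 <= l).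
Hypotheses (sF : F \subset Pi n k) (sH : H \subset Pi n l).
Hypothesis (cross : cross_tint t F H).

Lemma cross_tcover P : P \in F -> tcover H P.
Proof. by move=> PF; apply/tcoverP=> G; apply: cross. Qed.

Lemma branch_step Y c : ~~ tcover H Y ->
  (forall w, w \notin Y -> #|through F (w |: Y)| <= c) ->
  #|through F Y| <= (l - t + 1) * c.
Proof.
move=> /tcoverPn[G GH YG] lec.
have tl' : t <= l by lia.
have FG P : P \in through F Y -> t <= #|P :&: G|.
  by rewrite inE => /andP[PF _]; apply: cross.
have [W [sW cW hW]] := branch tl' (Pi_card sH GH) FG YG.
rewrite -cW; apply: (leq_card_union (B := fun w => through F (w |: Y))) => [P PF|w wW].
  have [w wW wP] := hW _ PF; exists w => //; move: PF; rewrite !inE => /andP[-> sYP].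
  by rewrite subUset sub1set wP.
by apply: lec; move: (subsetP sW _ wW); rewrite inE => /andP[].
Qed.

(** A set with fewer than [m] blocks is not a [t]-cover of [H], so branching continues until [m]
    blocks are fixed. *)
Lemma branch_bound m Y : m < k -> (forall T, tcover H T -> m <= #|T|) -> #|Y| <= m ->
  #|through F Y| <= (l - t + 1) ^ (m - #|Y|) * stir (n - m) (k - m).
Proof.
move=> mk minm; move e: (m - #|Y|) => d; elim: d Y e => [|d IH] Y e leY.
  rewrite mul1n (_ : m = #|Y|); last by lia.
  by apply: card_through_le => //; lia.
rewrite expnS -mulnA; apply: branch_step => [|w wY].
  by apply/negP=> /minm; lia.
by apply: IH; rewrite cardsU1 wY; lia.
Qed.

End Pair.
End Covers.

(** * Weights attached to the size of a minimal cover *)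

Section Numbers.
Variables n t N : nat.
Hypothesis t0 : 0 < t.

(** The numerical facts about a single index. Both [k1] and [k2] satisfy them with the same [N], so
    that the two families can exchange roles. *)
Definition admissible k :=
  [/\ t.+2 <= k, (t + 1) * (k - t + 1) <= N, k < n,
      (forall s, t <= s -> s + 2 <= k ->
         N ^ 2 * stir (n - s.+1) (k - s.+1) <= stir (n - s) (k - s))
    & N ^ 4 <= stir (n - k + 2) 2].

(** Here [m] is the size of a minimal [t]-cover of the opposite family, and [c] is the branching
    number inside its members. *)
Definition weight k c m := 'C(m, t) * c ^ (m - t) * stir (n - m) (k - m).

(* At [m = k] the count of partitions through [k] given blocks is still [1],
   hence the truncation at [k - 1]. *)
Definition cut_weight k c m :=
  'C(m, t) * (c ^ (minn m k.-1 - t) * stir (n - minn m k.-1) (k - minn m k.-1)).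

(** The quotient is [(m + 1) / (m + 1 - t)], largest at [m = t]. *)
Lemma leq_binS m : t <= m -> 'C(m.+1, t) <= (t + 1) * 'C(m, t).
Proof.
move=> tm; have := mul_bin_down m.+1 t => /= e.
have h : m.+1 <= (t + 1) * (m.+1 - t) by nia.
rewrite -(leq_pmul2l (m := m.+1 - t)); last by lia.
by rewrite -e mulnCA mulnA leq_mul2r h orbT.
Qed.

Section OneIndex.
Variables k c : nat.
Hypothesis (ad : admissible k) (cN : (t + 1) * c <= N) (c0 : 0 < c).

(** One of the two factors [N] pays for the binomial and the branching number; the other one is the
    gain. *)
Lemma weight_step m : t <= m -> m.+2 <= k -> N * weight k c m.+1 <= weight k c m.
Proof.
case: ad => _ _ _ st _ tm mk; have := st m tm; rewrite addn2 => /(_ mk) h.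
have N0 : 0 < N by nia.
rewrite -(leq_pmul2l N0) /weight subSn // expnS.
have hb := leq_binS tm.
move: ('C(m.+1, t)) ('C(m, t)) (c ^ (m - t)) (stir (n - m.+1) _) (stir (n - m) _) hb h.
move=> b' b x s' s hb h.
apply: leq_trans (_ : N * (N * ((t + 1) * b * (c * x) * s')) <= _).
  by rewrite !leq_mul2l !leq_mul2r hb !orbT.
have -> : N * (N * ((t + 1) * b * (c * x) * s')) = ((t + 1) * c) * (b * x * (N ^ 2 * s')).
  by rewrite -mulnn; lia.
by apply: leq_mul => //; rewrite leq_mul2l h orbT.
Qed.

Lemma weight_mono a m : t <= a -> a <= m -> m < k -> N ^ (m - a) * weight k c m <= weight k c a.
Proof.
move=> ta am; move e: (m - a) => d; elim: d m am e => [|d IH] m am e mk.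
  by rewrite mul1n (_ : m = a) //; lia.
case: m am e mk => [|m] am e mk; first by lia.
have am' : a <= m by lia.
apply: leq_trans (IH m am' _ _); [|lia|lia].
by rewrite expnSr -mulnA leq_mul2l weight_step ?orbT //; lia.
Qed.

Lemma cut_weight_eq m : m < k -> cut_weight k c m = weight k c m.
Proof. by move=> mk; rewrite /cut_weight /weight (minn_idPl _) ?mulnA //; lia. Qed.

Lemma cut_weight_top : cut_weight k c k <= (t + 1) * weight k c k.-1.
Proof.
case: ad => tk _ _ _ _; rewrite /cut_weight /weight (minn_idPr _) ?leq_pred //.
rewrite -mulnA [X in _ <= X]mulnA leq_mul2r; apply/orP; right.
have := @leq_binS k.-1; rewrite (_ : k.-1.+1 = k); last by lia.
by apply; lia.
Qed.

Local Notation p := (stir (n - t.+1) (k - t.+1)).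

Lemma weight_t1 : weight k c t.+1 = (t + 1) * c * p.
Proof. by rewrite /weight binSn subSn // subnn expn1 addn1. Qed.

(** At [m = k] the truncation costs an extra [t + 1]; for [k >= t + 3] there is at least one step
    from [t + 1] to [k - 1], whose gain [N] covers it. *)
Lemma cut_weight_le_t1 m : t.+1 <= m -> m <= k -> t.+3 <= k -> cut_weight k c m <= (t + 1) * c * p.
Proof.
move=> tm mk tk; rewrite -weight_t1.
have N0 : 0 < N by nia.
have [mlt|/eqP|] := ltngtP m k; [|lia|].
  rewrite cut_weight_eq //; apply: leq_trans (weight_mono (leqnSn t) tm mlt).
  by rewrite leq_pmull // expn_gt0 N0.
move=> ->; apply: leq_trans cut_weight_top _.
have h : N ^ (k.-1 - t.+1) * weight k c k.-1 <= weight k c t.+1 by apply: weight_mono; lia.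
apply: leq_trans h; rewrite leq_mul2r; apply/orP; right.
apply: leq_trans (_ : N ^ 1 <= _); first by rewrite expn1; nia.
by rewrite leq_pexp2l //; lia.
Qed.

(** Now [k - 1 = t + 1], no step is available, and the extra factor [t + 1] stays. *)
Lemma cut_weight_le_small m : k = t.+2 -> t.+1 <= m -> m <= k -> cut_weight k c m <= (t + 1) ^ 2 * c * p.
Proof.
move=> ek tm mk; have [mlt|] := ltnP m k.
  by rewrite cut_weight_eq // (_ : m = t.+1) ?weight_t1; [rewrite -mulnn; nia|lia].
move=> km; rewrite (_ : m = k); last by lia.
apply: leq_trans cut_weight_top _; rewrite (_ : k.-1 = t.+1) ?weight_t1; last by lia.
by rewrite -mulnn; lia.
Qed.

Lemma cut_weight_le_t2 m : t.+2 <= m -> m <= k -> t.+3 <= k -> cut_weight k c m <= p.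
Proof.
move=> tm mk tk; have N0 : 0 < N by nia.
have h2 : weight k c t.+2 <= p.
  rewrite -(leq_pmul2l N0); apply: leq_trans (weight_step _ _) _; [lia|lia|].
  by rewrite weight_t1 leq_mul2r cN orbT.
have [mlt|mge] := ltnP m k.
  rewrite cut_weight_eq //; apply: leq_trans h2.
  apply: leq_trans (weight_mono (ltnW (leqnSn t.+1)) tm mlt).
  by rewrite leq_pmull // expn_gt0 N0.
have {mge mk tm} -> : m = k by lia.
apply: leq_trans cut_weight_top _.
have [k4|k3] := leqP t.+4 k.
  have h : N ^ (k.-1 - t.+2) * weight k c k.-1 <= weight k c t.+2 by apply: weight_mono; lia.
  apply: leq_trans h2; apply: leq_trans h; rewrite leq_mul2r; apply/orP; right.
  apply: leq_trans (_ : N ^ 1 <= _); first by rewrite expn1; nia.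
  by rewrite leq_pexp2l //; lia.
(* No step lies between [t + 2] and [k - 1], so the extra [t + 1] is absorbed differently: [p]
   counts partitions into two blocks and is at least [N ^ 4]. *)
have ek : k = t.+3 by lia.
case: ad => _ _ kn _; rewrite ek => big.
rewrite /weight -[t.+3.-1]/t.+2.
have -> : t.+3 - t.+2 = 1 by lia.
have -> : t.+2 - t = 2 by lia.
have -> : n - t.+2 = (n - t.+3).+1 by lia.
have -> : n - t.+1 = n - t.+3 + 2 by lia.
have -> : t.+3 - t.+1 = 2 by lia.
rewrite stir1 muln1.
apply: leq_trans big.
have b2 : 'C(t.+2, t) <= (t + 1) * ((t + 1) * 1).
  apply: leq_trans (leq_binS (leqnSn t)) _; rewrite leq_mul2l; apply/orP; right.
  by apply: leq_trans (leq_binS (leqnn t)) _; rewrite binn.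
apply: leq_trans (_ : (t + 1) * ((t + 1) * ((t + 1) * 1) * c ^ 2) <= _).
  by rewrite leq_mul2l leq_mul2r b2 !orbT.
apply: leq_trans (_ : ((t + 1) * c) ^ 4 <= _); last by rewrite leq_exp2r.
rewrite expnMn; have c2 : c ^ 2 <= c ^ 4 by rewrite leq_pexp2l.
have -> : (t + 1) * ((t + 1) * ((t + 1) * 1) * c ^ 2) = (t + 1) ^ 3 * c ^ 2.
  by rewrite !expnS expn0; lia.
by rewrite leq_mul // leq_pexp2l //; lia.
Qed.

End OneIndex.
End Numbers.

Lemma level_gt0 n t N k : admissible n t N k -> 0 < stir (n - t.+1) (k - t.+1).
Proof. by case=> h1 _ h2 _ _; apply: stir_gt0; lia. Qed.

Lemma level_step n t N k : admissible n t N k ->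
  N ^ 2 * stir (n - t.+1) (k - t.+1) <= stir (n - t) (k - t).
Proof. by case=> h1 _ _ st _; apply: st; lia. Qed.

Lemma level_step_small n t N k : admissible n t N k -> k = t.+2 ->
  N ^ 4 * stir (n - t.+1) (k - t.+1) <= stir (n - t) (k - t).
Proof.
move=> [_ _ kn _ big] ek; move: big; rewrite ek.
have -> : t.+2 - t.+1 = 1 by lia.
have -> : t.+2 - t = 2 by lia.
have -> : n - t.+1 = (n - t.+2).+1 by lia.
by have -> : n - t.+2 + 2 = n - t; [lia | rewrite stir1 muln1].
Qed.

(** * Upper bounds from the sizes of minimal covers *)

Section Balanced.
Variables (n t N k l : nat) (F H : pfamily_of n).
Hypotheses (t0 : 0 < t) (adk : admissible n t N k) (adl : admissible n t N l).
Hypotheses (sF : F \subset Pi n k) (sH : H \subset Pi n l).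
Hypotheses (cross : cross_tint t F H) (F0 : F != set0) (H0 : H != set0).

Lemma cross_tintC (F' H' : pfamily_of n) : cross_tint t F' H' -> cross_tint t H' F'.
Proof. by move=> c A B AH BF; rewrite setIC; apply: c. Qed.

Let tk : t.+2 <= k. Proof. by case: adk. Qed.
Let tl : t.+2 <= l. Proof. by case: adl. Qed.

(** Every member of [F] contains a [t]-subset of [Tf]; from there one branches up to the minimal
    cover size of [H], but not beyond [k - 1] blocks. *)
Lemma card_family_le (Tf Th : spart n) : tcover t F Tf ->
  (forall T, tcover t H T -> #|Th| <= #|T|) -> t <= #|Th| ->
  #|F| <= 'C(#|Tf|, t) * ((l - t + 1) ^ (minn #|Th| k.-1 - t) *
            stir (n - minn #|Th| k.-1) (k - minn #|Th| k.-1)).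
Proof.
move=> cTf minTh tTh; apply: card_cover_le => // Z _ cZ; rewrite -{2}cZ.
apply: (branch_bound tk tl sF sH cross); first by lia.
  by move=> T /minTh; lia.
by rewrite cZ; lia.
Qed.


Local Notation p := (stir (n - t.+1) (k - t.+1)).
Local Notation p' := (stir (n - t.+1) (l - t.+1)).
Local Notation s' := (stir (n - t) (l - t)).

Let ck : (t + 1) * (k - t + 1) <= N. Proof. by case: adk. Qed.
Let cl : (t + 1) * (l - t + 1) <= N. Proof. by case: adl. Qed.

Lemma min_tcover_opposite : exists Th : spart n,
  [/\ tcover t H Th, t <= #|Th| <= k & forall T, tcover t H T -> #|Th| <= #|T|].
Proof.
have [P PF] := set0Pn _ F0.
have [Th [cTh leTh minTh]] := min_tcover (cross_tcover cross PF).
by exists Th; rewrite (leq_tcover H0 cTh) -(Pi_card sF PF).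
Qed.

(** The common [t]-set makes the binomial for [F] equal to 1. What remains besides [s'] is a single
    weight of level at least [t + 2], hence at most [p]. *)
Lemma unique_cover_bound (X : spart n) : #|X| = t -> tcover t F X -> t.+3 <= k ->
  (forall T, tcover t H T -> t.+2 <= #|T|) -> #|F| * #|H| <= p * s'.
Proof.
move=> cX covX k3 noT; have [Th [cTh /andP[tTh Thk] minTh]] := min_tcover_opposite.
have := card_family_le covX minTh tTh; rewrite cX binn mul1n => leF.
have leH : #|H| <= 'C(#|Th|, t) * s'.
  apply: card_cover_le => // Z _ cZ; rewrite -cZ; apply: card_through_le => //; lia.
apply: leq_trans (leq_mul leF leH) _; rewrite mulnA leq_mul2r; apply/orP; right.
rewrite mulnC -/(cut_weight n t k (l - t + 1) #|Th|); apply: (cut_weight_le_t2 t0 adk cl) => //; try lia.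
exact: noT.
Qed.

End Balanced.

Section BalancedPair.
Variables (n t N k l : nat) (F H : pfamily_of n).
Hypotheses (t0 : 0 < t) (adk : admissible n t N k) (adl : admissible n t N l).
Hypotheses (sF : F \subset Pi n k) (sH : H \subset Pi n l).
Hypotheses (cross : cross_tint t F H) (F0 : F != set0) (H0 : H != set0).

Local Notation p := (stir (n - t.+1) (k - t.+1)).
Local Notation p' := (stir (n - t.+1) (l - t.+1)).
Local Notation s' := (stir (n - t) (l - t)).

Let ck : (t + 1) * (k - t + 1) <= N. Proof. by case: adk. Qed.
Let cl : (t + 1) * (l - t + 1) <= N. Proof. by case: adl. Qed.

(** Both weights are of level at least [t + 1], and the step from [p'] to [s'] must pay for their
    constants. By [l <= k], if [l >= t + 3] then neither index is exceptional and [N ^ 2] suffices.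
    If [l = t + 2], both weights may carry an extra [t + 1], but this step then gains [N ^ 4]. *)
Lemma no_cover_bound : l <= k ->
  (forall T, tcover t F T -> t.+1 <= #|T|) ->
  (forall T, tcover t H T -> t.+1 <= #|T|) -> #|F| * #|H| <= p * s'.
Proof.
move=> lk noF noH.
have tk : t.+2 <= k by case: adk.
have tl : t.+2 <= l by case: adl.
have [Th [cTh /andP[tTh Thk] minTh]] := min_tcover_opposite sF cross F0 H0.
have [Tf [cTf /andP[tTf Tfl] minTf]] := min_tcover_opposite sH (cross_tintC cross) H0 F0.
have leF := card_family_le t0 adk adl sF sH cross F0 H0 cTf minTh tTh.
have leH := card_family_le t0 adl adk sH sF (cross_tintC cross) H0 F0 cTh minTf tTf.
(* The two binomials change places: the bound for [F] has the binomial of the cover of [F] but the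
   branching depth of the cover of [H], and conversely. *)
have {leF leH} : #|F| * #|H| <= cut_weight n t k (l - t + 1) #|Th| * cut_weight n t l (k - t + 1) #|Tf|.
  apply: leq_trans (leq_mul leF leH) _; rewrite /cut_weight.
  by rewrite mulnACA ['C(#|Tf|, t) * _]mulnC -mulnACA.
move/leq_trans; apply.
have c'0 : 0 < l - t + 1 by lia.
have c0 : 0 < k - t + 1 by lia.
have hTh := noH _ cTh; have hTf := noF _ cTf.
have N0 : 0 < N by nia.
have [l3|l2] := leqP t.+3 l.
  have vk := cut_weight_le_t1 t0 adk cl c'0 hTh Thk (leq_trans l3 lk).
  have vl := cut_weight_le_t1 t0 adl ck c0 hTf Tfl l3.
  apply: leq_trans (leq_mul vk vl) _.
  have := level_step adl; move: (leq_mul cl ck); rewrite mulnn.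
  move: ((t + 1) * (l - t + 1)) ((t + 1) * (k - t + 1)) p p' s' (N ^ 2) => x y a b c z h1 h2.
  rewrite mulnACA mulnCA leq_mul2l; apply/orP; right; apply: leq_trans h2.
  by rewrite leq_mul2r h1 orbT.
have el : l = t.+2 by lia.
have vl := cut_weight_le_small t0 adl ck c0 el hTf Tfl.
have vk : cut_weight n t k (l - t + 1) #|Th| <= (t + 1) ^ 2 * (l - t + 1) * p.
  have [k3|k2] := leqP t.+3 k; last by apply: (cut_weight_le_small t0 adk cl c'0 _ hTh Thk); lia.
  apply: leq_trans (cut_weight_le_t1 t0 adk cl c'0 hTh Thk k3) _.
  by rewrite -!mulnn !leq_mul2r; apply/orP; right; apply/orP; right; nia.
apply: leq_trans (leq_mul vk vl) _.
have hl : (t + 1) ^ 2 * (l - t + 1) <= N ^ 2.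
  by rewrite -!mulnn; apply: leq_trans (leq_mul cl cl); nia.
have hk : (t + 1) ^ 2 * (k - t + 1) <= N ^ 2.
  by rewrite -!mulnn; apply: leq_trans (leq_mul ck ck); nia.
have := level_step_small adl el; move: (leq_mul hl hk); rewrite -expnD.
move: (_ * (l - t + 1)) (_ * (k - t + 1)) p p' s' (N ^ (2 + 2)) => x y a b c z h1 h2.
rewrite mulnACA mulnCA leq_mul2l; apply/orP; right; apply: leq_trans h2.
by rewrite leq_mul2r h1 orbT.
Qed.

End BalancedPair.

(** * The four constructions *)

Section Constructions.
Variable n : nat.
Implicit Types (P Q G T X Y Z M W : spart n) (F H : pfamily_of n).

Lemma Cfam_sub k T : Cfam n k T \subset Pi n k.
Proof. by apply/subsetP=> P /setIdP[]. Qed.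

Lemma Dfam_sub l t T : Dfam n l t T \subset Pi n l.
Proof. by apply/subsetP=> P /setIdP[]. Qed.

Lemma Afam_sub k X M : Afam n k X M \subset Pi n k.
Proof. by apply/subsetP=> P /setIdP[]. Qed.

Lemma CD_cross k l t T : cross_tint t (Cfam n k T) (Dfam n l t T).
Proof.
move=> P G /setIdP[_ sTP] /setIdP[_ tG]; apply: leq_trans tG _.
by apply/subset_leq_card/setSI.
Qed.

Lemma cover_setD1 M B : trivIset M -> set0 \notin M -> B \in M ->
  B :|: ~: cover M = ~: cover (M :\ B).
Proof.
move=> tM M0 BM; rewrite coverD1 // setCD setUC //.
Qed.

Lemma extra_part M B : trivIset M -> set0 \notin M -> B \in M ->
  partition (M :\ B :|: [set B :|: ~: cover M]) setT /\
  #|M :\ B :|: [set B :|: ~: cover M]| = #|M|.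
Proof.
move=> tM M0 BM; rewrite cover_setD1 // setUC; set C := ~: cover _.
have tMB : trivIset (M :\ B) by apply: trivIsetD.
have MB0 : set0 \notin M :\ B by rewrite inE (negbTE M0) andbF.
have C0 : C != set0.
  rewrite /C -cover_setD1 //; apply: contraNneq M0 => e.
  suff <- : B = set0 by [].
  by apply/eqP; rewrite -subset0 -e subsetUl.
have pMB : partition (M :\ B) (cover (M :\ B)) by rewrite /partition eqxx tMB.
have dis : [disjoint C & cover (M :\ B)] by rewrite disjoints_subset subxx.
split.
  have -> : [set: 'I_n] = C :|: cover (M :\ B) by rewrite setUC setUCr.
  exact: partitionU1.
rewrite cardsU1 (cardsD1 B M) BM; congr (_ + _).
case: (boolP (C \in _)) => // CM; case/set0Pn: C0 => x xC.
have : x \in cover (M :\ B) by apply/bigcupP; exists C.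
by rewrite (disjointFr dis).
Qed.

Lemma Bfam_sub l X M : trivIset M -> set0 \notin M -> #|M| = l -> X \subset M ->
  Bfam n l X M \subset Pi n l.
Proof.
move=> tM M0 cM sXM; apply/subsetP=> G /setUP[/setIdP[]//|/imsetP[B BX ->]].
have [pE cE] := extra_part tM M0 (subsetP sXM _ BX).
by rewrite inE /is_kpart pE cE cM eqxx.
Qed.

(** An exceptional member of [Bfam] lacks one block of [X]; a block of [M] outside [X] in the member
    of [Afam] makes up for it. *)
Lemma AB_cross k l t X M : X \subset M -> #|X| = t ->
  cross_tint t (Afam n k X M) (Bfam n l X M).
Proof.
move=> sXM cX P G /setIdP[_ /andP[sXP /set0Pn[b /setIP[bP /setDP[bM bX]]]]].
case/setUP=> [/setIdP[_ sXG]|/imsetP[B BX ->]].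
  by rewrite -cX; apply/subset_leq_card; rewrite subsetI sXP.
rewrite -cX (cardsD1 B) BX add1n.
have <- : #|b |: X :\ B| = #|X :\ B|.+1 by rewrite cardsU1 !inE (negbTE bX) andbF.
apply/subset_leq_card; rewrite subUset sub1set !inE bP bM andbT /=.
rewrite (_ : b != B); last by apply: contraNneq bX => ->.
apply/subsetP=> C /setD1P[CB CX]; rewrite !inE CB (subsetP sXP) //=.
by rewrite (subsetP sXM).
Qed.

Section Sizes.
Variables t N k l : nat.
Hypotheses (t0 : 0 < t) (adk : admissible n t N k) (adl : admissible n t N l).

Local Notation p := (stir (n - t.+1) (k - t.+1)).
Local Notation q := (stir (n - t.+2) (k - t.+2)).
Local Notation p' := (stir (n - t.+1) (l - t.+1)).
Local Notation s' := (stir (n - t) (l - t)).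

Lemma N_ge6 : 6 <= N.
Proof. by case: adk => h1 h2 _ _ _; nia. Qed.

(** A common block outside [Y] would leave at most [p'] of the [s'] partitions through [Y]. *)
Lemma common_block_Cfam Y B : singletons Y -> #|Y| = t ->
  (forall G, G \in Cfam n l Y -> B \in G) -> B \in Y.
Proof.
move=> sY cY all; apply/negPn/negP=> BY.
have tl : t.+2 <= l by case: adl.
have le : #|Cfam n l Y| <= #|Cfam n l (B |: Y)|.
  apply/subset_leq_card/subsetP=> G GY; have BG := all _ GY.
  by move/setIdP: GY => [GP sYG]; apply/setIdP; rewrite subUset sub1set BG.
have le2 : #|Cfam n l (B |: Y)| <= p'.
  by have := @card_Cfam_le n l (B |: Y); rewrite cardsU1 BY cY; apply; lia.
move: le; rewrite card_Cfam_singletons // cY; last by lia.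
have := level_step adl; have := level_gt0 adl; have square_ge36 : 6 ^ 2 <= N ^ 2 by rewrite leq_exp2r // N_ge6.
move: p' s' (N ^ 2) le2 square_ge36 => a b c; rewrite -[6 ^ 2]/36; nia.
Qed.

(** A common block would belong to every [t]-subset of [T], and these have empty intersection. *)
Lemma CD_nontrivial T : singletons T -> #|T| = t.+1 ->
  nontrivial t (Cfam n k T) (Dfam n l t T).
Proof.
move=> sT cT; rewrite /nontrivial (_ : common_blocks _ _ = set0) ?cards0 //.
apply/eqP; rewrite -subset0; apply/subsetP=> B.
rewrite [B \in common_blocks _ _]inE => /forall_inP all.
have key Y : Y \subset T -> #|Y| = t -> B \in Y.
  move=> sYT cY; apply: common_block_Cfam => //; first exact: singletonsS sT.
  move=> G /setIdP[GP sYG]; apply: all; apply/setUP; right; apply/setIdP; split=> //.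
  by rewrite -cY; apply/subset_leq_card; rewrite subsetI sYT.
have [BT|BT] := boolP (B \in T).
  have cB : #|T :\ B| = t by have := cardsD1 B T; rewrite BT cT; lia.
  by move: (key _ (subD1set _ _) cB); rewrite setD11.
have [Y sY cY] := @exists_subset _ T t ltac:(lia).
by move: (subsetP sY _ (key _ sY cY)); rewrite (negbTE BT).
Qed.

Lemma AB_nontrivial X M : singletons M -> #|M| = l -> X \subset M -> #|X| = t ->
  nontrivial t (Afam n k X M) (Bfam n l X M).
Proof.
move=> sM cM sXM cX; rewrite /nontrivial (_ : common_blocks _ _ = set0) ?cards0 //.
apply/eqP; rewrite -subset0; apply/subsetP=> B.
rewrite [B \in common_blocks _ _]inE => /forall_inP all.
have BX : B \in X.
  apply: common_block_Cfam => //; first exact: singletonsS sM.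
  by move=> G GX; apply: all; rewrite !in_setU GX orbT.
(* The exceptional member built from [B] itself contains [B] only if [M] covers everything, whereas
   its singletons cover [l < n] points. *)
have /all : M :\ B :|: [set B :|: ~: cover M] \in Afam n k X M :|: Bfam n l X M.
  by rewrite !in_setU; apply/orP; right; apply/orP; right; apply/imsetP; exists B.
rewrite !inE eqxx /= => /eqP eB.
have [_ _ cov] := singletons_trivIset sM.
have : #|~: cover M| = n - l by rewrite cardsCs setCK card_ord cov cM.
have ln : l < n by case: adl.
have [->|[x xC]] := set_0Vmem (~: cover M); first by rewrite cards0; lia.
have : x \in cover M; last by move: xC; rewrite inE => /negbTE->.
by apply/bigcupP; exists B; [exact: (subsetP sXM) | rewrite eB inE xC orbT].
Qed.

Lemma card_Cfam_sum j Y : #|Cfam n j Y| = \sum_(G in Pi n j) (Y \subset G).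
Proof.
rewrite -sum1_card [RHS](eq_bigr (fun G => if Y \subset G then 1 else 0)).
  rewrite -big_mkcondr /=; apply: eq_bigl => G; by rewrite inE.
by move=> G _; case: (Y \subset G).
Qed.

(** Double counting of the pairs of [x] in [T] and [G] containing [T :\ x]: a partition through all
    of [T] occurs [t + 1] times, any other member of [Dfam] once. *)
Lemma card_Dfam_ge T : singletons T -> #|T| = t.+1 ->
  (t + 1) * s' <= #|Dfam n l t T| + t * p'.
Proof.
move=> sT cT; have tl : t.+2 <= l by case: adl.
have -> : p' = #|Cfam n l T| by rewrite card_Cfam_singletons // cT //; lia.
have -> : (t + 1) * s' = \sum_(x in T) #|Cfam n l (T :\ x)|.
  rewrite (eq_bigr (fun _ => s')); first by rewrite sum_nat_const cT addn1.
  move=> x xT; have c : #|T :\ x| = t by have := cardsD1 x T; rewrite xT cT; lia.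
  have := @card_Cfam_singletons n l (T :\ x) (singletonsS (subD1set _ _) sT).
  by rewrite c; apply; lia.
rewrite (eq_bigr (fun x => \sum_(G in Pi n l) (T :\ x \subset G))); last first.
  by move=> x _; rewrite card_Cfam_sum.
rewrite exchange_big /= card_Cfam_sum big_distrr /=.
have -> : #|Dfam n l t T| = \sum_(G in Pi n l) (t <= #|T :&: G|).
  rewrite -sum1_card [RHS](eq_bigr (fun G => if t <= #|T :&: G| then 1 else 0)).
    by rewrite -big_mkcondr /=; apply: eq_bigl => G; rewrite inE.
  by move=> G _; case: (t <= _).
rewrite -big_split /=; apply: leq_sum => G _.
have [sTG|] := boolP (T \subset G).
  rewrite (setIidPl sTG) cT leqnSn muln1.
  apply: leq_trans (_ : \sum_(x in T) 1 <= _); first by apply: leq_sum => x _; apply: leq_b1.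
  by rewrite sum1_card cT.
case/subsetPn=> y yT yG; rewrite muln0 addn0 (bigD1 y) //= big1 ?addn0.
  case: (boolP (T :\ y \subset G)) => // sG /=.
  rewrite (_ : t <= _) //; have <- : #|T :\ y| = t by have := cardsD1 y T; rewrite yT cT; lia.
  by apply/subset_leq_card; rewrite subsetI subD1set.
move=> x /andP[xT xy]; case: (boolP (T :\ x \subset G)) => // /subsetP/(_ y).
by rewrite !inE eq_sym xy yT (negbTE yG) => /(_ isT).
Qed.

(** Bonferroni's inequality for the blocks of [M] outside [X], pointwise [a <= 1 + 'C(a, 2)] for
    [a > 0]. *)
Lemma card_Afam_ge X M : singletons M -> #|M| = l -> X \subset M -> #|X| = t ->
  (l - t) * p <= #|Afam n k X M| + 'C(l - t, 2) * q.
Proof.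
move=> sM cM sXM cX; have tk : t.+2 <= k by case: adk.
have cMX : #|M :\: X| = l - t by rewrite cardsD (setIidPr sXM) cM cX.
pose D2 := [set W : spart n | W \subset M :\: X & #|W| == 2].
have cY W : W \subset M :\: X -> #|X :|: W| = t + #|W|.
  move=> sW; rewrite cardsU cX (_ : X :&: W = set0) ?cards0 ?subn0 //.
  apply/setP=> B; rewrite !inE; case BW: (B \in W); rewrite ?andbF // andbT.
  by move: (subsetP sW _ BW); rewrite inE => /andP[/negbTE].
have sY W : W \subset M :\: X -> singletons (X :|: W).
  move=> sW; apply: singletonsS sM; rewrite subUset sXM.
  exact: subset_trans sW (subsetDl _ _).
have -> : (l - t) * p = \sum_(b in M :\: X) #|Cfam n k (X :|: [set b])|.
  rewrite (eq_bigr (fun _ => p)); first by rewrite sum_nat_const cMX.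
  move=> b bM; have sb : [set b] \subset M :\: X by rewrite sub1set.
  by rewrite card_Cfam_singletons ?sY // cY // cards1 addn1 //; lia.
have -> : 'C(l - t, 2) * q = \sum_(W in D2) #|Cfam n k (X :|: W)|.
  rewrite (eq_bigr (fun _ => q)); first by rewrite sum_nat_const cards_draws cMX.
  move=> W; rewrite inE => /andP[sW /eqP cW].
  by rewrite card_Cfam_singletons ?sY // cY // cW addn2 //; lia.
rewrite (eq_bigr (fun b => \sum_(G in Pi n k) (X :|: [set b] \subset G))); last first.
  by move=> x _; rewrite card_Cfam_sum.
rewrite [X in _ + X](eq_bigr (fun W => \sum_(G in Pi n k) (X :|: W \subset G))); last first.
  by move=> x _; rewrite card_Cfam_sum.
rewrite exchange_big [X in _ + X]exchange_big /=.
have -> : #|Afam n k X M| = \sum_(G in Pi n k) ((X \subset G) && (G :&: (M :\: X) != set0)).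
  rewrite -sum1_card [RHS](eq_bigr (fun G =>
    if (X \subset G) && (G :&: (M :\: X) != set0) then 1 else 0)).
    by rewrite -big_mkcondr /=; apply: eq_bigl => G; rewrite inE.
  by move=> G _; case: (_ && _).
rewrite -big_split /=; apply: leq_sum => G _.
have [sXG|nXG] := boolP (X \subset G); last first.
  by rewrite big1 // => b _; rewrite subUset (negbTE nXG).
set A := G :&: (M :\: X).
have -> : \sum_(b in M :\: X) (X :|: [set b] \subset G) = #|A|.
  rewrite -sum1_card [LHS](eq_bigr (fun b => if b \in G then 1 else 0)).
    by rewrite -big_mkcondr /=; apply: eq_bigl => b; rewrite !inE andbC.
  by move=> b _; rewrite subUset sXG sub1set; case: (b \in G).
have -> : \sum_(W in D2) (X :|: W \subset G) = 'C(#|A|, 2).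
  rewrite -cards_draws -sum1_card [LHS](eq_bigr (fun W => if W \subset G then 1 else 0)).
    rewrite -big_mkcondr /=; apply: eq_bigl => W; rewrite !inE subsetI.
    by rewrite andbC andbA.
  by move=> W _; rewrite subUset sXG; case: (W \subset G).
rewrite -card_gt0; case: #|A| => [|[|m]] //; rewrite binS bin1 /=; lia.
Qed.

End Sizes.
End Constructions.

Lemma double_bin2_leq m : 2 * 'C(m, 2) <= m * m.
Proof.
rewrite bin2 mul2n; apply: leq_trans (_ : m * m.-1 <= _).
  by rewrite -[X in _ <= X]odd_double_half leq_addl.
by rewrite leq_mul2l leq_pred orbT.
Qed.

Lemma sing_singletons n s : singletons (sing n s).
Proof. by apply/singletonsP=> B /imsetP[x _ ->]; exists x. Qed.

Lemma card_sing n s : s <= n -> #|sing n s| = s.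
Proof.
move=> sn; rewrite card_imset; last exact: set1_inj.
have e : \sum_(i < s) 1 = \sum_(i < n | i < s) 1 := big_ord_widen n (fun=> 1) sn.
by rewrite sum1_card card_ord sum1dep_card in e; rewrite {2}e; apply: eq_card => i; rewrite !inE.
Qed.

Lemma sing_subset n s s' : s <= s' -> sing n s \subset sing n s'.
Proof.
move=> ss; apply/subsetP=> B /imsetP[x xs ->]; apply: imset_f.
by rewrite !inE in xs *; apply: leq_trans ss.
Qed.

(** * Lower bounds for the maximum [B] of the product *)

Section LowerBounds.
Variables (n t N k l B : nat).
Hypotheses (t0 : 0 < t) (adk : admissible n t N k) (adl : admissible n t N l).
Hypothesis maxB : forall G1 G2 : pfamily_of n, G1 \subset Pi n k -> G2 \subset Pi n l ->
  cross_tint t G1 G2 -> nontrivial t G1 G2 -> #|G1| * #|G2| <= B.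

Local Notation p := (stir (n - t.+1) (k - t.+1)).
Local Notation q := (stir (n - t.+2) (k - t.+2)).
Local Notation p' := (stir (n - t.+1) (l - t.+1)).
Local Notation s' := (stir (n - t) (l - t)).

Lemma lower_CD : (t + 1) * (p * s') <= B + t * (p * p').
Proof.
have [tk _ kn _ _] := adk.
pose T := sing n t.+1.
have sT : singletons T := sing_singletons _ _.
have cT : #|T| = t.+1 by rewrite card_sing; lia.
have := maxB (Cfam_sub k T) (Dfam_sub l t T) (@CD_cross n k l t T)
  (CD_nontrivial t0 adk adl sT cT).
have := card_Dfam_ge t0 adl sT cT.
have -> : #|Cfam n k T| = p by rewrite card_Cfam_singletons // cT //; lia.
move: p p' s' #|Dfam _ _ _ _| => x y z d h1 h2.
have := leq_mul (leqnn x) h1; nia.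
Qed.

Lemma lower_AB : (l - t) * (p * s') <= B + 'C(l - t, 2) * (q * s').
Proof.
have [tl _ ln _ _] := adl.
pose X := sing n t; pose M := sing n l.
have sM : singletons M := sing_singletons _ _.
have cM : #|M| = l by rewrite card_sing; lia.
have cX : #|X| = t by rewrite card_sing; lia.
have sXM : X \subset M by apply: sing_subset; lia.
have [tM M0 _] := singletons_trivIset sM.
have := maxB (Afam_sub k X M) (Bfam_sub tM M0 cM sXM) (AB_cross (k := k) (l := l) sXM cX)
  (AB_nontrivial t0 adk adl sM cM sXM cX).
have := card_Afam_ge t0 adk sM cM sXM cX.
have hB : s' <= #|Bfam n l X M|.
  have <- : #|Cfam n l X| = s'.
    by rewrite card_Cfam_singletons ?cX //; [exact: singletonsS sM | lia].
  exact/subset_leq_card/subsetUl.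
move: p q s' #|Afam _ _ _ _| #|Bfam _ _ _ _| 'C(_, 2) hB => x y z a b c hB h1 h2.
have := leq_mul h1 (leqnn z); have := leq_mul (leqnn a) hB; nia.
Qed.

Let N6 : 6 <= N. Proof. exact: N_ge6 t0 adk. Qed.

(** Since [t + 1 >= 2] and [s' >= N ^ 2 * p' >= 36 p'], the pair (C, D) beats [p s'] by a constant
    factor. Every bound by [p s'] thus contradicts maximality. *)
Lemma lower_weak : 3 * (p * s') <= 2 * B.
Proof.
have := lower_CD; have := level_step adl; have square_ge36 : 6 ^ 2 <= N ^ 2 by rewrite leq_exp2r.
move: p p' s' (N ^ 2) square_ge36 => x y z M; rewrite -[6 ^ 2]/36 => hM hy h.
have h1 : 36 * (x * y) <= x * z by nia.
have h2 : t * (36 * (x * y)) <= t * (x * z) by rewrite leq_mul2l h1 orbT.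
have h3 : x * z <= t * (x * z) by nia.
lia.
Qed.

Lemma next_level_step : N ^ 2 * q <= p.
Proof.
have [tk _ kn st _] := adk; have [k3|k2] := leqP t.+3 k.
  by apply: st; lia.
have -> : k - t.+2 = 0 by lia.
have -> : n - t.+2 = (n - t.+3).+1 by lia.
by rewrite stirS0 muln0.
Qed.

(** Here [a] is the number of heavy blocks. Compared with (A, B), at least one of the [l - t] terms
    [p s'] is missing, and it outweighs all terms that contain [q] or [p']. *)
Lemma middle_range a f h : 0 < a -> a < l - t ->
  f <= a * p + (l - t - a) * ((l - t + 1) * q) ->
  h <= s' + t * ((k - t) * p') -> f * h < B.
Proof.
move=> a0 ak leF leH; rewrite ltnNge; apply/negP=> leB.
have lA := lower_AB; have hq := next_level_step; have hp := level_step adl.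
have p0 := level_gt0 adk; have p'0 := level_gt0 adl.
have [_ ck _ _ _] := adk; have [_ cl _ _ _] := adl.
have s0 : 0 < s' by nia.
have C2 := double_bin2_leq (l - t).
move: lA hq hp p0 s0 leF leH C2.
set K := l - t in ak cl *; set D := t * (k - t).
have -> : t * ((k - t) * p') = D * p' by rewrite mulnA.
have hD : D <= N by rewrite /D; nia.
have hK : 2 * (K + 1) <= N by nia.
move: p q p' s' 'C(K, 2) {ck p'0} => x y y' z c lA hq hp x0 z0 leF leH C2.
set M := N ^ 2 in hq hp; have eM : M = N * N by rewrite /M -mulnn.
pose e := K - a; have e0 : 0 < e by rewrite /e; lia.
have eK : K = a + e by rewrite /e; lia.
rewrite -/e in leF.
have fM : M * f <= (a * M + e * (K + 1)) * x.
  apply: leq_trans (leq_mul (leqnn M) leF) _.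
  have := leq_mul (leqnn (e * (K + 1))) hq; lia.
have hM : M * h <= (M + D) * z.
  apply: leq_trans (leq_mul (leqnn M) leH) _.
  have := leq_mul (leqnn D) hp; lia.
have h1 := leq_mul fM hM.
have h2 : K * M * M * (x * z) <= M * M * B + c * M * (x * z).
  have := leq_mul (leqnn (M * M)) lA.
  have := leq_mul (leqnn (c * M * z)) hq; lia.
have h3 : M * M * B <= M * M * (f * h) by rewrite leq_mul2l leB orbT.
have fin : (a * M + e * (K + 1)) * (M + D) + c * M < K * M * M.
  have aN : 2 * a <= N by lia.
  have KN : 2 * K <= N by lia.
  have g1 : 2 * (a * D) <= M by rewrite eM mulnA leq_mul.
  have g2 : 8 * c <= M.
    by rewrite eM; have := leq_mul KN KN; move: C2; clear; lia.
  have g3 : 12 * (K + 1) <= M.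
    by rewrite eM; have := leq_mul N6 (leqnn N); move: hK; clear; lia.
  have g4 : 2 * ((K + 1) * D) <= M by rewrite eM mulnA leq_mul.
  have M36 : 36 <= M by rewrite eM; apply: leq_mul N6 N6.
  have f1 : 2 * (a * D * M) <= M * M by have := leq_mul g1 (leqnn M); lia.
  have f2 : 8 * (c * M) <= M * M by have := leq_mul g2 (leqnn M); lia.
  have f3 : 12 * (e * (K + 1) * M) <= e * (M * M).
    by have := leq_mul (leqnn (e * M)) g3; lia.
  have f4 : 72 * (e * (K + 1) * D) <= e * (M * M).
    have := leq_mul (leqnn e) (leq_mul M36 g4); lia.
  have f5 : M * M <= e * (M * M) by rewrite leq_pmull.
  have f6 : 0 < M * M by rewrite muln_gt0; move: M36; clear; lia.
  have -> : K * M * M = a * (M * M) + e * (M * M) by rewrite eK; lia.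
  lia.
have xz0 : 0 < x * z by rewrite muln_gt0 x0 z0.
have : ((a * M + e * (K + 1)) * (M + D) + c * M) * (x * z) < K * M * M * (x * z).
  by rewrite ltn_pmul2r.
move: h1 h2 h3; clear; lia.
Qed.

End LowerBounds.

(** * Families with [t] common blocks *)

Lemma partition_block_eq (T : finType) (G : {set {set T}}) D (B C : {set T}) y :
  partition G D -> B \in G -> C \in G -> y \in B -> y \in C -> B = C.
Proof.
move=> /partition_trivIset tG BG CG yB yC.
by rewrite -(def_pblock tG BG yB) (def_pblock tG CG yC).
Qed.

Lemma partition_card1 (T : finType) (Q : {set {set T}}) D :
  partition Q D -> #|Q| = 1 -> Q = [set D].
Proof.
move=> pQ /eqP/cards1P[B eQ]; rewrite eQ; congr [set _].
by rewrite -(cover_partition pQ) eQ /cover big_set1.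
Qed.

Lemma partition_card2 (T : finType) (Q : {set {set T}}) D b :
  partition Q D -> #|Q| = 2 -> b \in Q -> Q = [set b; D :\: b].
Proof.
move=> pQ cQ bQ; rewrite -(setD1K bQ); congr (_ :|: _).
apply: partition_card1; first exact: partitionD1.
by have := cardsD1 b Q; rewrite bQ cQ; lia.
Qed.

Section Role.
Variables (n t N k l : nat) (F H : pfamily_of n) (X : spart n).
Implicit Types (P G : spart n) (b c w : block n).
Hypotheses (t0 : 0 < t) (adk : admissible n t N k) (adl : admissible n t N l).
Hypotheses (sF : F \subset Pi n k) (sH : H \subset Pi n l).
Hypotheses (cross : cross_tint t F H) (F0 : F != set0) (H0 : H != set0).
Hypotheses (cX : #|X| = t) (XF : forall P, P \in F -> X \subset P).
Hypothesis (nX : ~~ tcover t H X).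

Let tk : t.+2 <= k. Proof. by case: adk. Qed.
Let tl : t.+2 <= l. Proof. by case: adl. Qed.

Local Notation p := (stir (n - t.+1) (k - t.+1)).
Local Notation q := (stir (n - t.+2) (k - t.+2)).
Local Notation p' := (stir (n - t.+1) (l - t.+1)).
Local Notation s' := (stir (n - t) (l - t)).

Definition heavy : {set block n} :=
  [set b | [&& b \notin X, tcover t H (b |: X) & through F (b |: X) != set0]].

Lemma card_XG G : ~~ (X \subset G) -> #|X :&: G| < t.
Proof.
move=> nXG; rewrite -cX proper_card // properEneq subsetIl andbT.
by apply: contra nXG => /eqP/setIidPl.
Qed.

Lemma exists_nonX : exists2 G, G \in H & ~~ (X \subset G).
Proof.
have [G GH lt] := tcoverPn nX; exists G => //; apply: contraL lt => /setIidPl->.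
by rewrite cX ltnn.
Qed.

Lemma meets_complement P G : P \in F -> G \in H -> ~~ (X \subset G) ->
  exists2 b, b \in P :\: X & b \in G.
Proof.
move=> PF GH nXG; have := cross PF GH; have := card_XG nXG => lt le.
have : ~~ (P :&: G \subset X :&: G).
  by apply/negP=> /subset_leq_card; nlia.
case/subsetPn=> w /setIP[wP wG]; rewrite inE wG andbT => wX.
by exists w => //; rewrite inE wX.
Qed.

(** [G] contains at most [t - 1] blocks of [X] but [t] of [b |: X], hence [b] and all blocks of [X]
    except one. *)
Lemma tcover_nonX G b : G \in H -> ~~ (X \subset G) -> tcover t H (b |: X) ->
  b \in G /\ exists x, [/\ x \in X, x \notin G & X :\ x \subset G].
Proof.
move=> GH nXG /tcoverP/(_ _ GH); have := card_XG nXG.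
rewrite setIUl => lt le.
have {le} tle : t <= #|[set b] :&: G| + #|X :&: G|.
  exact: leq_trans le (leq_card_setU _ _).
have [x xX xG] := subsetPn nXG.
have bG : b \in G.
  apply: contraLR tle => bG; rewrite -ltnNge (_ : [set b] :&: G = set0) ?cards0 //.
  by apply/eqP; rewrite setI_eq0 disjoints1.
have b1 : #|[set b] :&: G| <= 1.
  by apply: leq_trans (subset_leq_card (subsetIl _ _)) _; rewrite cards1.
split=> //; exists x; split=> //.
have sub1 : X :&: G \subset X :\ x.
  apply/subsetP=> B /setIP[BX BG]; rewrite !inE BX andbT.
  by apply: contraNneq xG => <-.
have c1 : #|X :\ x| = t.-1 by have := cardsD1 x X; rewrite xX cX; nlia.
have le1 : t.-1 <= #|X :&: G| by nlia.
have /eqP <- : X :&: G == X :\ x by rewrite eqEcard sub1 c1 le1.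
exact: subsetIr.
Qed.

(** Take the block of [G] through a point of [x]: in every member of [F] that point lies in [x],
    which is not a block of [G]. *)
Lemma missing_block G x : G \in H -> x \in X -> x \notin G ->
  exists c, [/\ c \in G, c \notin X & forall P, P \in F -> c \notin P].
Proof.
move=> GH xX xG; have [P0 P0F] := set0Pn _ F0.
have pG := Pi_partition sH GH.
have notP P : P \in F -> forall y c, y \in x -> c \in G -> y \in c -> c \notin P.
  move=> PF y c yx cG yc; apply/negP=> cP; move: xG.
  by rewrite (partition_block_eq (Pi_partition sF PF) (subsetP (XF PF) _ xX) cP yx yc) cG.
have /set0Pn[y yx] := partition_neq0 (Pi_partition sF P0F) (subsetP (XF P0F) _ xX).
have yc : y \in cover G by rewrite (cover_partition pG).
exists (pblock G y); rewrite pblock_mem //; split=> //.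
  apply/negP=> /(subsetP (XF P0F)); apply/negP; apply: notP yx _ _ => //.
    by rewrite pblock_mem.
  by rewrite mem_pblock.
by move=> P PF; apply: notP yx _ _ => //; rewrite ?pblock_mem ?mem_pblock.
Qed.

(* A block of [G] that meets the missing block of [X] lies in no member of
   [F], so one branch of the generic argument is lost. *)
Lemma heavy_structure G b : G \in H -> ~~ (X \subset G) -> b \in heavy ->
  exists2 R : {set block n},
    [/\ heavy \subset R, R \subset G :\: X & #|R| = l - t]
    & forall P, P \in F -> exists2 w, w \in R & w \in P.
Proof.
move=> GH nXG; rewrite inE => /and3P[_ covb _].
have [_ [x [xX xG sXG]]] := tcover_nonX GH nXG covb.
have [c [cG ncX cF]] := missing_block GH xX xG.
have c1 : #|X :\ x| = t.-1 by have := cardsD1 x X; rewrite xX cX; nlia.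
have eXG : G :&: X = X :\ x.
  apply/setP=> B; rewrite !inE; case: (eqVneq B x) => [->|Bx] /=.
    by rewrite (negbTE xG).
  case BX: (B \in X); rewrite ?andbF // andbT.
  by apply: (subsetP sXG); rewrite !inE Bx.
exists ((G :\: X) :\ c).
  split; last 1 first.
  - have := cardsD1 c (G :\: X); rewrite inE cG ncX /=.
    rewrite cardsD eXG c1 (Pi_card sH GH) => e.
    by apply/eqP; rewrite -(eqn_add2l 1) -e; apply/eqP; nlia.
  - apply/subsetP=> d; rewrite inE => /and3P[dX covd /set0Pn[P /setIdP[PF sdP]]].
    rewrite !inE dX (tcover_nonX GH nXG covd).1 !andbT.
    apply: contraNneq (cF _ PF) => <-; apply: (subsetP sdP).
    exact: setU11.
  exact: subD1set.
move=> P PF; have [w /setDP[wP wX] wG] := meets_complement PF GH nXG.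
exists w => //; rewrite !inE wX wG !andbT.
by apply: contraTneq wP => ->; apply: cF.
Qed.

Lemma light_bound w : t.+3 <= k -> w \notin X -> w \notin heavy ->
  #|through F (w |: X)| <= (l - t + 1) * q.
Proof.
move=> k3 wX; rewrite inE wX /= negb_and negbK => /orP[nc|/eqP->]; last by rewrite cards0.
apply: (branch_step tk tl sF sH cross nc) => v vwX.
have := @card_through_le n k F (v |: (w |: X)) sF; rewrite cardsU1 vwX cardsU1 wX cX.
by apply; nlia.
Qed.

(** * The index [t + 2]: members of [F] are splittings of [V] into two halves *)

Section SmallIndex.
Hypotheses (k2 : k = t.+2) (F2 : 1 < #|F|).
Let V := setT :\: cover X.

Lemma complement_part P : P \in F -> partition (P :\: X) V /\ #|P :\: X| = 2.
Proof.
move=> PF; split; first exact: partition_setD (Pi_partition sF PF) (XF PF).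
by rewrite cardsD (setIidPr (XF PF)) (Pi_card sF PF) cX; nlia.
Qed.

Lemma complement_block P b : P \in F -> b \in P :\: X ->
  P :\: X = [set b; V :\: b] /\ b \subset V.
Proof.
move=> PF bP; have [pP cP] := complement_part PF.
by split; [apply: partition_card2 | apply: partitionS bP].
Qed.

Lemma complement_eq P P' b : P \in F -> P' \in F -> b \in P :\: X -> b \in P' :\: X ->
  P = P'.
Proof.
move=> PF P'F bP bP'; rewrite -(setID P X) -(setID P' X).
rewrite (setIidPr (XF PF)) (setIidPr (XF P'F)).
by rewrite (complement_block PF bP).1 (complement_block P'F bP').1.
Qed.

Lemma complement_neq0 P b : P \in F -> b \in P :\: X -> exists2 y, y \in b & y \in V.
Proof.
move=> PF bP; have [pP _] := complement_part PF.
have /set0Pn[y yb] := partition_neq0 pP bP; exists y => //.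
exact: (subsetP (partitionS pP bP)).
Qed.

(** If [G] contained both halves of [P], the block outside [X] that it shares with [P'] would meet
    one of them, hence equal it; but one half determines the partition. *)
Lemma only_one_half P P' G b : P \in F -> P' \in F -> P != P' -> G \in H ->
  ~~ (X \subset G) -> b \in P :\: X -> b \in G -> V :\: b \notin G.
Proof.
move=> PF P'F ne GH nXG bP bG; apply/negP=> cG.
have [b' b'P' b'G] := meets_complement P'F GH nXG.
have [y yb' yV] := complement_neq0 P'F b'P'.
have [eP _] := complement_block PF bP.
have pG := Pi_partition sH GH; case/eqP: ne.
have [yb|yb] := boolP (y \in b).
  by apply: complement_eq PF P'F bP _; rewrite (partition_block_eq pG bG b'G yb yb').
have yc : y \in V :\: b by rewrite inE yb.
apply: (complement_eq (b := V :\: b)) => //; first by rewrite eP set22.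
by rewrite (partition_block_eq pG cG b'G yc yb').
Qed.

(** Otherwise [G] contains the other half [V :\: b]. The half [b'] of [P'] in [G0] is disjoint from
    [b], so it lies inside [V :\: b]. Whichever half of [P'] belongs to [G], either it meets
    [V :\: b] and therefore equals it, or [V :\: b = b']; both give [P = P']. *)
Lemma half_stable P P' G0 G b : P \in F -> P' \in F -> P != P' ->
  G0 \in H -> ~~ (X \subset G0) -> G \in H -> ~~ (X \subset G) ->
  b \in P :\: X -> b \in G0 -> b \in G.
Proof.
move=> PF P'F ne G0H nX0 GH nXG bP bG0; have [eP sbV] := complement_block PF bP.
have [d dP dG] := meets_complement PF GH nXG.
have: d \in [set b; V :\: b] by rewrite -eP.
case/set2P=> ed; first by rewrite -ed.
rewrite {}ed in dP dG.
have [b' b'P' b'G0] := meets_complement P'F G0H nX0.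
have [eP' sbV'] := complement_block P'F b'P'.
have dis y : y \in b -> y \in b' -> False.
  move=> yb yb'; case/eqP: ne; apply: complement_eq PF P'F bP _.
  by rewrite (partition_block_eq (Pi_partition sH G0H) bG0 b'G0 yb yb').
have neb' : V :\: b \notin P' :\: X.
  by apply: contra ne => dP'; apply/eqP; apply: complement_eq PF P'F dP dP'.
have pG := Pi_partition sH GH.
have [d' d'P' d'G] := meets_complement P'F GH nXG.
have: d' \in [set b'; V :\: b'] by rewrite -eP'.
have [y yb' yV] := complement_neq0 P'F b'P'.
have yb : y \notin b by apply/negP=> /dis; apply.
case/set2P=> ed'.
  case/negP: neb'; rewrite (partition_block_eq (y := y) pG dG d'G) //.
    by rewrite inE yb.
  by rewrite ed'.
case/negP: neb'.
have [emp|[z /setIP[zd zd']]] := set_0Vmem ((V :\: b) :&: (V :\: b')).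
  suff -> : V :\: b = b' by [].
  apply/setP=> z; apply/idP/idP => zb.
    apply: contraT => zb'; have : z \in (V :\: b) :&: (V :\: b').
      by move: zb; rewrite !inE zb' /= => /andP[-> ->].
    by rewrite emp inE.
  by rewrite inE (subsetP sbV') // andbT; apply/negP=> /dis; apply.
by rewrite (partition_block_eq pG dG d'G zd) // ed'.
Qed.

(** Substitute for [light_bound] at [k = t + 2]: a second member of [F] forces all of [H] outside
    [X] to use the same half of [P], which is therefore heavy. *)
Lemma heavy_of_small P : P \in F -> exists2 b, b \in heavy & b \in P.
Proof.
move=> PF; have [P' P'F ne] : exists2 P', P' \in F & P != P'.
  have : 0 < #|F :\ P| by move: F2; rewrite (cardsD1 P F) PF add1n ltnS.
  by rewrite card_gt0 => /set0Pn[P' /setD1P[ne P'F]]; exists P' => //; rewrite eq_sym.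
have [G0 G0H nX0] := exists_nonX.
have [b bP bG0] := meets_complement PF G0H nX0.
move: (bP); rewrite inE => /andP[bX bP']; exists b => //.
rewrite inE bX /=; apply/andP; split; last first.
  by apply/set0Pn; exists P; rewrite inE PF subUset sub1set bP' XF.
apply/tcoverP=> G GH; have [sXG|nXG] := boolP (X \subset G).
  by rewrite -cX; apply/subset_leq_card; rewrite subsetI subsetUr.
have bG := half_stable PF P'F ne G0H nX0 GH nXG bP bG0.
have ncG := only_one_half PF P'F ne GH nXG bP bG.
have [eP _] := complement_block PF bP.
(* The other half of [P] is not in [G], so what [P] shares with [G] lies in [b |: X]. *)
apply: leq_trans (cross PF GH) _; apply/subset_leq_card/subsetP=> B /setIP[BP BG].
rewrite !inE BG andbT; have [//|BX] := boolP (B \in X); first by rewrite orbT.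
have : B \in [set b; V :\: b] by rewrite -eP inE BX.
by case/set2P=> e; rewrite e ?eqxx // in ncG BG *; rewrite BG in ncG.
Qed.

End SmallIndex.

Section Generic.
Hypothesis gen : t.+3 <= k \/ 1 < #|F|.

Lemma heavy_small_or P : P \in F -> t.+3 <= k \/ exists2 b, b \in heavy & b \in P.
Proof.
case: (leqP t.+3 k) => [|k2] PF; [by left | right].
by case: gen => [|F2]; [nlia | apply: heavy_of_small => //; nlia].
Qed.

Lemma card_heavy_le : heavy != set0 -> #|heavy| <= l - t.
Proof.
case/set0Pn=> b bh; have [G GH nXG] := exists_nonX.
by have [R [sR _ <-] _] := heavy_structure GH nXG bh; apply: subset_leq_card.
Qed.

(** A member without heavy block contains a light block of [R], of which there are
    [l - t - #|heavy|]. At [k = t + 2] no such member exists. *)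
Lemma card_F_heavy : heavy != set0 ->
  #|F| <= #|heavy| * p + (l - t - #|heavy|) * ((l - t + 1) * q).
Proof.
move=> h0; have [b bh] := set0Pn _ h0; have [G GH nXG] := exists_nonX.
have [R [sR sRG cR] RF] := heavy_structure GH nXG bh.
pose F' := [set P in F | [exists b in heavy, b \in P]].
rewrite -(cardsID F' F) leq_add //.
  apply: (leq_card_union (B := fun b => through F (b |: X))) => [P|d].
    rewrite !inE => /and3P[PF _ /exists_inP[d dh dP]]; exists d => //.
    by rewrite inE PF subUset sub1set dP XF.
  rewrite inE => /andP[dX _]; have := @card_through_le n k F (d |: X) sF.
  by rewrite cardsU1 dX cX; apply; nlia.
have -> : l - t - #|heavy| = #|R :\: heavy| by rewrite cardsD (setIidPr sR) cR.
have [k3|k2] := leqP t.+3 k.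
  apply: (leq_card_union (B := fun b => through F (b |: X))) => [P|d].
    rewrite !inE => /andP[nh PF]; have [w wR wP] := RF _ PF.
    exists w; last by rewrite inE PF subUset sub1set wP XF.
    rewrite inE wR andbT; move: nh; rewrite PF /=; apply: contra => wh.
    by apply/exists_inP; exists w.
  case/setDP=> dR dh; apply: light_bound => //.
  by move: (subsetP sRG _ dR); rewrite inE => /andP[].
rewrite (_ : F :\: F' = set0) ?cards0 //; apply/setP=> P; rewrite !inE.
case PF: (P \in F); rewrite ?andbF //= andbT.
have [|[d dh dP]] := heavy_small_or PF; first by nlia.
by apply/negbTE; rewrite negbK; apply/exists_inP; exists d.
Qed.

Lemma card_F_light : heavy = set0 -> t.+3 <= k /\
  #|F| <= (l - t + 1) * ((l - t + 1) * q).
Proof.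
move=> h0; have [P PF] := set0Pn _ F0.
have [k3|[b]] := heavy_small_or PF; last by rewrite h0 inE.
split=> //; have eF : through F X = F.
  by apply/setP=> Q; rewrite inE; case QF: (Q \in F) => //=; rewrite XF.
rewrite -{1}eF; apply: (branch_step tk tl sF sH cross nX) => w wX.
by apply: light_bound => //; rewrite h0 inE.
Qed.

(** A member of [H] not containing [X] contains [b], all but one block of [X], and some block of
    [P :\: X]. The latter differs from [b] as [b] is not in [P], so [t + 1] blocks are fixed in
    [t (k - t)] ways. *)
Lemma card_H_heavy b P : b \in heavy -> P \in F -> b \notin P ->
  #|H| <= s' + t * ((k - t) * p').
Proof.
rewrite inE => /and3P[bX covb _] PF bP.
rewrite -(cardsID (through H X) H) leq_add //.
  apply: leq_trans (_ : #|through H X| <= _); first exact/subset_leq_card/subsetIr.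
  by rewrite -cX; apply: card_through_le => //; nlia.
have cPX : #|P :\: X| = k - t by rewrite cardsD (setIidPr (XF PF)) (Pi_card sF PF) cX.
rewrite -{1}cX -cPX.
apply: (leq_card_union
  (B := fun x => \bigcup_(f in P :\: X) through H (f |: (b |: X :\ x)))) => [G|x xX].
  rewrite !inE => /andP[+ GH]; rewrite GH /= => nXG.
  have [bG [x [xX xG sXG]]] := tcover_nonX GH nXG covb.
  exists x => //; apply/bigcupP.
  have [f fP fG] := meets_complement PF GH nXG.
  by exists f => //; rewrite inE GH !subUset !sub1set fG bG.
apply: (leq_card_union (B := fun f => through H (f |: (b |: X :\ x)))) => [G /bigcupP[f fP fG]|f].
  by exists f.
case/setDP=> fP fX; have := @card_through_le n l H (f |: (b |: X :\ x)) sH.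
have fb : f != b by apply: contraNneq bP => <-.
rewrite !cardsU1 !inE (negbTE fb) (negbTE fX) (negbTE bX) !andbF /=.
have := cardsD1 x X; rewrite xX cX => e.
have -> : 1 + (1 + #|X :\ x|) = t.+1 by nlia.
by apply; nlia.
Qed.

End Generic.
End Role.

Lemma leq_mul_squeeze a b a' b' : 0 < a -> 0 < b -> a <= a' -> b <= b' ->
  a' * b' <= a * b -> a' <= a /\ b' <= b.
Proof. by move=> *; split; nia. Qed.

(** * Maximal pairs in which one family has a common [t]-set *)

Section Maximal.
Variables (n t N k l : nat) (F H : pfamily_of n).
Implicit Types (P G T W M : spart n) (b c w x : block n).
Hypotheses (t0 : 0 < t) (adk : admissible n t N k) (adl : admissible n t N l).
Hypotheses (sF : F \subset Pi n k) (sH : H \subset Pi n l).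
Hypotheses (cross : cross_tint t F H) (F0 : F != set0) (H0 : H != set0).
Hypothesis ntr : nontrivial t F H.
Hypothesis maxFH : forall G1 G2 : pfamily_of n, G1 \subset Pi n k -> G2 \subset Pi n l ->
  cross_tint t G1 G2 -> nontrivial t G1 G2 -> #|G1| * #|G2| <= #|F| * #|H|.

Let tk : t.+2 <= k. Proof. by case: adk. Qed.
Let tl : t.+2 <= l. Proof. by case: adl. Qed.

Local Notation p := (stir (n - t.+1) (k - t.+1)).
Local Notation q := (stir (n - t.+2) (k - t.+2)).
Local Notation p' := (stir (n - t.+1) (l - t.+1)).
Local Notation s' := (stir (n - t) (l - t)).

Lemma nontrivialS (F' H' : pfamily_of n) : F \subset F' -> H \subset H' ->
  nontrivial t F' H'.
Proof.
move=> sFF' sHH'; apply: leq_ltn_trans ntr; apply/subset_leq_card/subsetP=> B.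
rewrite !inE => /forall_inP all; apply/forall_inP=> P PFH; apply: all.
by apply: subsetP PFH; apply: setUSS.
Qed.

(** Enlarging families only removes common blocks, so the larger pair is still non-trivial and
    competes with the maximal one. *)
Lemma maximal_eq (F' H' : pfamily_of n) : F \subset F' -> H \subset H' ->
  F' \subset Pi n k -> H' \subset Pi n l -> cross_tint t F' H' -> F = F' /\ H = H'.
Proof.
move=> sFF' sHH' sF' sH' cr; have := maxFH sF' sH' cr (nontrivialS sFF' sHH').
have fle := subset_leq_card sFF'; have hle := subset_leq_card sHH'.
have f0 : 0 < #|F| by rewrite card_gt0.
have h0 : 0 < #|H| by rewrite card_gt0.
move=> le; have [e1 e2] := leq_mul_squeeze f0 h0 fle hle le.
by split; apply/eqP; rewrite eqEcard ?sFF' ?sHH' ?e1 ?e2.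
Qed.

Lemma weak_contra : #|F| * #|H| <= p * s' -> False.
Proof.
have := lower_weak t0 adk adl maxFH.
have : 0 < p * s'.
  rewrite muln_gt0 (level_gt0 adk); apply: leq_trans (level_step adl).
  have [_ c _ _ _] := adl.
  by rewrite muln_gt0 (level_gt0 adl) andbT expn_gt0; apply/orP; left; nnia.
nlia.
Qed.

(** In both forms the prescribed blocks are not yet known to be singletons. For (A, B) disjointness
    and non-emptiness are recorded because they put [Bfam] inside [Pi n l]. *)
Definition CD_form := exists T : spart n,
  [/\ #|T| = t.+1, F = Cfam n k T & H = Dfam n l t T].
Definition AB_form := exists X M : spart n,
  [/\ X \subset M, #|X| = t, #|M| = l, trivIset M /\ set0 \notin M
    & F = Afam n k X M /\ H = Bfam n l X M].

Lemma CD_form_of T : #|T| = t.+1 -> (forall P, P \in F -> T \subset P) ->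
  tcover t H T -> CD_form.
Proof.
move=> cT TF /tcoverP TH; exists T.
have sFC : F \subset Cfam n k T.
  by apply/subsetP=> P PF; apply/setIdP; rewrite (subsetP sF) // TF.
have sHD : H \subset Dfam n l t T.
  by apply/subsetP=> G GH; apply/setIdP; rewrite (subsetP sH) // TH.
by have [-> ->] := maximal_eq sFC sHD (Cfam_sub k T) (Dfam_sub l t T) (@CD_cross n k l t T).
Qed.

Section Generic.
Variable X : spart n.
Hypotheses (cX : #|X| = t) (XF : forall P, P \in F -> X \subset P).
Hypothesis (nX : ~~ tcover t H X).
Hypothesis gen : t.+3 <= k \/ 1 < #|F|.

Local Notation heavy := (heavy t F H X).

Lemma XcoverF : tcover t F X.
Proof. by apply/tcoverP=> P /XF/setIidPl->; rewrite cX. Qed.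

(** Without heavy blocks two further branchings give [#|F| <= (l - t + 1) ^ 2 * q]. If [H] has a
    cover of size at most [t + 1], then [#|H| <= (t + 1) s'], and the constants are at most [N ^ 2],
    the drop from [p] to [q]; otherwise covers of size [t + 2] or more suffice. *)
Lemma heavy_neq0 : heavy != set0.
Proof.
apply/eqP=> h0.
have [k3 leF] := card_F_light t0 adk adl sF sH cross F0 cX XF nX gen h0.
have [_ cl _ _ _] := adl.
apply: weak_contra; case: (boolP [exists T : spart n, tcover t H T && (#|T| <= t.+1)]); last first.
  move/existsPn=> noT.
  apply: (unique_cover_bound t0 adk adl sF sH cross F0 H0 cX XcoverF k3) => T cT.
  by move: (noT T); rewrite cT /= -ltnNge.
case/existsP=> T /andP[cT leT].
have leH : #|H| <= (t + 1) * s'.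
  apply: leq_trans (card_cover_le (c := s') cT _) _.
    by move=> Z _ cZ; rewrite -cZ; apply: card_through_le => //; nlia.
  rewrite leq_mul2r; apply/orP; right.
  apply: leq_trans (_ : 'C(t.+1, t) <= _); first exact: leq_bin2l.
  by rewrite binSn addn1.
apply: leq_trans (leq_mul leF leH) _.
have hq := next_level_step t0 adk.
rewrite mulnA leq_mul2r; apply/orP; right; apply: leq_trans hq.
move: cl; set c := l - t + 1; move: q => y cl.
have : (t + 1) * (c * c) <= N * N by nnia.
by rewrite -mulnn; move: (t + 1) N => u M h; have := leq_mul h (leqnn y); nlia.
Qed.

(** With [l - t] heavy blocks the set [R] of [heavy_structure] is exactly [heavy]. So every member
    of [F] contains a heavy block, and [M] is [X] together with all of them. *)
Lemma AB_form_full : #|heavy| = l - t -> AB_form.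
Proof.
move=> ch; have [b0 bh0] := set0Pn _ heavy_neq0.
have [G0 G0H nX0] := exists_nonX cX nX.
have hX b : b \in heavy -> b \notin X by rewrite inE => /and3P[].
have hF b : b \in heavy -> exists2 P, P \in F & b \in P.
  rewrite inE => /and3P[_ _ /set0Pn[P /setIdP[PF sP]]]; exists P => //.
  by apply: (subsetP sP); rewrite setU11.
have hG G b : G \in H -> ~~ (X \subset G) -> b \in heavy -> b \in G.
  by move=> GH nXG; rewrite inE => /and3P[_ cb _]; case: (tcover_nonX t0 adk adl cX GH nXG cb).
pose M := X :|: heavy.
have dXh : X :&: heavy = set0.
  apply/eqP; rewrite setI_eq0 disjoints_subset; apply/subsetP=> B BX.
  by rewrite in_setC; apply/negP=> /hX; rewrite BX.
have cM : #|M| = l by rewrite /M cardsU dXh cards0 cX ch subn0; nlia.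
have sXM : X \subset M by apply: subsetUl.
have tM : trivIset M.
  apply/trivIsetP=> A B /setUP[AX|Ah] /setUP[BX|Bh] ne.
  - have [P PF] := set0Pn _ F0; have /trivIsetP tP := partition_trivIset (Pi_partition sF PF).
    by apply: tP => //; apply: (subsetP (XF PF)).
  - have [P PF BP] := hF _ Bh; have /trivIsetP tP := partition_trivIset (Pi_partition sF PF).
    by apply: tP => //; apply: (subsetP (XF PF)).
  - have [P PF AP] := hF _ Ah; have /trivIsetP tP := partition_trivIset (Pi_partition sF PF).
    by apply: tP => //; apply: (subsetP (XF PF)).
  - have /trivIsetP tG := partition_trivIset (Pi_partition sH G0H).
    by apply: tG => //; apply: hG.
have M0 : set0 \notin M.
  apply/setUP=> -[X0|h0].
    have [P PF] := set0Pn _ F0; move: (subsetP (XF PF) _ X0).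
    by rewrite (partition0 (Pi_partition sF PF)).
  by have [P PF] := hF _ h0; rewrite (partition0 (Pi_partition sF PF)).
have FA : F \subset Afam n k X M.
  apply/subsetP=> P PF; apply/setIdP; rewrite (subsetP sF) // XF //=; split=> //.
  have [R [sR sRG cR] RF] := heavy_structure t0 adk adl sF sH cross F0 cX XF G0H nX0 bh0.
  have eR : heavy = R by apply/eqP; rewrite eqEcard sR cR ch /=.
  have [w wR wP] := RF _ PF; rewrite -eR in wR.
  by apply/set0Pn; exists w; rewrite in_setI wP in_setD hX // in_setU wR orbT.
have HB : H \subset Bfam n l X M.
  apply/subsetP=> G GH; have [sXG|nXG] := boolP (X \subset G).
    by apply/setUP; left; apply/setIdP; rewrite (subsetP sH).
  have bh := bh0; rewrite inE in bh; case/and3P: bh => _ cb _.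
  have [_ [x [xX xG sXG]]] := tcover_nonX t0 adk adl cX GH nXG cb.
  apply/setUP; right; apply/imsetP; exists x => //.
  have xM : x \in M by apply: (subsetP sXM).
  (* These [l - 1] blocks force the last block of [G] to be the rest of the ground set. *)
  have sMG : M :\ x \subset G.
    apply/subsetP=> B /setD1P[Bx /setUP[BX|]]; last exact: hG.
    by apply: (subsetP sXG); rewrite !inE Bx.
  have := partition_card1 (partition_setD (Pi_partition sH GH) sMG).
  rewrite cardsD (setIidPr sMG) (Pi_card sH GH).
  have -> : l - #|M :\ x| = 1 by have := cardsD1 x M; rewrite xM cM; nlia.
  move=> /(_ erefl) e; rewrite cover_setD1 // -setTD -e.
  by rewrite -{1}(setID G (M :\ x)) (setIidPr sMG).
exists X, M; split=> //.
apply: maximal_eq => //; first exact: Afam_sub.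
  exact: Bfam_sub.
exact: AB_cross.
Qed.

Lemma role_generic : CD_form \/ AB_form.
Proof.
have h0 := heavy_neq0.
case: (boolP [exists b in heavy, [forall P in F, b \in P]]) => [/exists_inP[b bh /forall_inP bF]|].
  left; move: bh; rewrite inE => /and3P[bX cb _].
  apply: CD_form_of cb; first by rewrite cardsU1 bX cX.
  by move=> P PF; rewrite subUset sub1set bF // XF.
move/exists_inPn=> nb; right.
have nb' b : b \in heavy -> exists2 P, P \in F & b \notin P.
  by move/nb/forall_inPn=> [P PF bP]; exists P.
have le := card_heavy_le t0 adk adl sF sH cross F0 cX XF nX h0.
have [lt|ge] := ltnP #|heavy| (l - t); last first.
  by apply: AB_form_full; apply/eqP; rewrite eqn_leq le.
have [b bh] := set0Pn _ h0; have [P PF bP] := nb' _ bh.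
have leF := card_F_heavy t0 adk adl sF sH cross F0 cX XF nX gen h0.
have leH := card_H_heavy t0 adk adl sF sH cross cX XF bh PF bP.
have a0 : 0 < #|heavy| by rewrite card_gt0.
by have := middle_range t0 adk adl maxFH a0 lt leF leH; rewrite ltnn.
Qed.

End Generic.
End Maximal.

(** The exponent is at least [b - 1], so a large [b] suffices. For small [b], already
    [2 ^ v <= 4 * (2 ^ b.-1) ^ 2] is of order [(t + 1) ^ 2], while [2 ^ n] contains
    [N ^ 6 >= 216 (t + 1) ^ 3]. *)
Lemma pair_weight n t N b v : 0 < b -> 0 < t -> 6 <= N -> t + 1 <= N ->
  2 ^ (2 * t + 2) * N ^ 6 <= 2 ^ n -> v <= 2 * b -> b + t.-1 + v <= n ->
  4 * (t + 1) <= 2 ^ (n - t - v).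
Proof.
move=> b0 t0 N6 tN big vb bv.
have [le|lt] := leqP (4 * (t + 1)) (2 ^ b.-1).
  by apply: leq_trans le _; rewrite leq_exp2l //; lia.
rewrite leqNgt; apply/negP=> lt2; move: big; apply/negP; rewrite -ltnNge.
have -> : 2 ^ n = 2 ^ (n - t - v) * 2 ^ t * 2 ^ v.
  by rewrite -!expnD; congr (_ ^ _); lia.
have -> : 2 ^ (2 * t + 2) = 2 ^ t * 2 ^ t * 4.
  by rewrite -[4]/(2 ^ 2) -!expnD; congr (_ ^ _); lia.
set x := 2 ^ (n - t - v) in lt2 *; set y := 2 ^ b.-1 in lt; set z := 2 ^ t.
have z0 : 0 < z by rewrite expn_gt0.
have z2 : 2 <= z by rewrite -{1}(expn1 2) leq_exp2l.
have hv : 2 ^ v <= 4 * (y * y).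
  rewrite /y -expnD (_ : 4 = 2 ^ 2) // -expnD leq_exp2l //; lia.
have hN : 216 * ((t + 1) * (t + 1) * (t + 1)) <= N ^ 6.
  rewrite (_ : N ^ 6 = N * N * N * (N * N * N)); last by rewrite !expnS expn0; lia.
  apply: leq_mul; last by rewrite !leq_mul.
  by apply: leq_trans (_ : 6 * 6 * 6 <= _) => //; rewrite !leq_mul.
have yy : y * y <= 16 * ((t + 1) * (t + 1)).
  by have := leq_mul (ltnW lt) (ltnW lt); lia.
move: (2 ^ v) (N ^ 6) hv hN => e M hv hN.
have h1 : x * e <= 4 * (t + 1) * (64 * ((t + 1) * (t + 1))).
  by apply: leq_mul; [exact: ltnW | lia].
have h2 : x * e < 8 * M by nia.
have h3 : x * z * e < z * (8 * M) by rewrite mulnAC mulnC ltn_pmul2l.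
apply: leq_trans h3 _; rewrite -!mulnA leq_mul2l; apply/orP; right.
by rewrite [z * _]mulnA leq_mul2r; apply/orP; right; lia.
Qed.

(** * Comparison of sizes: prescribed blocks are singletons *)

Section Final.
Variables (n t N k l : nat) (F H : pfamily_of n).
Implicit Types (P G T W M X : spart n) (b c w x : block n).
Hypotheses (t0 : 0 < t) (adk : admissible n t N k) (adl : admissible n t N l).
Hypotheses (sF : F \subset Pi n k) (sH : H \subset Pi n l).
Hypotheses (cross : cross_tint t F H) (F0 : F != set0) (H0 : H != set0).
Hypothesis ntr : nontrivial t F H.
Hypothesis maxFH : forall G1 G2 : pfamily_of n, G1 \subset Pi n k -> G2 \subset Pi n l ->
  cross_tint t G1 G2 -> nontrivial t G1 G2 -> #|G1| * #|G2| <= #|F| * #|H|.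

Let tk : t.+2 <= k. Proof. by case: adk. Qed.
Let tl : t.+2 <= l. Proof. by case: adl. Qed.
Let ln : l < n. Proof. by case: adl. Qed.

Local Notation p := (stir (n - t.+1) (k - t.+1)).
Local Notation q := (stir (n - t.+2) (k - t.+2)).
Local Notation p' := (stir (n - t.+1) (l - t.+1)).
Local Notation s' := (stir (n - t) (l - t)).
Local Notation h' := (stir (n - t.+1) (l - t)).

Lemma double_shift_le : 2 * h' <= s'.
Proof.
rewrite (_ : n - t = (n - t.+1).+1); last by nlia.
by apply: leq_trans (stir_mulS _ _); rewrite leq_mul2r; apply/orP; right; nlia.
Qed.

Lemma card_drop T x : #|T| = t.+1 -> x \in T -> #|T :\ x| = t.
Proof. by move=> cT xT; move: cT; rewrite (cardsD1 x T) xT add1n => -[]. Qed.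

Lemma subset_D1 T G : #|T| = t.+1 -> t <= #|T :&: G| -> exists2 x, x \in T & T :\ x \subset G.
Proof.
move=> cT tG; have [sTG|] := boolP (T \subset G).
  have /set0Pn[x xT] : T != set0 by rewrite -card_gt0 cT.
  by exists x => //; apply: subset_trans sTG; apply: subD1set.
case/subsetPn=> x xT xG; exists x => //.
have s1 : T :&: G \subset T :\ x.
  apply/subsetP=> B /setIP[BT BG]; rewrite !inE BT andbT.
  by apply: contraNneq xG => <-.
suff <- : T :&: G = T :\ x by apply: subsetIr.
by apply/eqP; rewrite eqEcard s1 (card_drop cT xT).
Qed.

(** Only one of the [t + 1] subsets [T :\ x] avoids [c]; the other [t] contain the large block and
    lose a point. *)
Lemma card_Dfam_block T c : #|T| = t.+1 -> c \in T -> 1 < #|c| ->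
  #|Dfam n l t T| <= s' + t * h'.
Proof.
move=> cT cT' c1.
apply: leq_trans (_ : \sum_(x in T) #|Cfam n l (T :\ x)| <= _).
  apply: leq_card_sum_union => G /setIdP[GP /(subset_D1 cT)[x xT sx]].
  by exists x => //; apply/setIdP.
rewrite (bigD1 c) //= leq_add //.
  have := @card_Cfam_le n l (T :\ c); rewrite (card_drop cT cT'); apply; nlia.
apply: leq_trans (_ : \sum_(x in T | x != c) h' <= _).
  apply: leq_sum => x /andP[xT xc].
  have cTc : c \in T :\ x by rewrite !inE eq_sym xc.
  by have := @card_Cfam_block n l (T :\ x) c; rewrite (card_drop cT xT); apply => //; nlia.
rewrite sum_nat_const leq_mul2r; apply/orP; right.
rewrite -(card_drop cT cT'); apply/subset_leq_card/subsetP=> x.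
by rewrite !inE => /andP[-> ->].
Qed.

Lemma square_ge36 : 36 <= N ^ 2.
Proof. by have := N_ge6 t0 adk => h; rewrite -[36]/(6 ^ 2) leq_exp2r. Qed.

Lemma numeric_facts : [/\ 36 * p' <= s', 0 < p', 0 < p, 0 < s' & 36 * t <= s'].
Proof.
have h1 := level_step adl; have p'0 := level_gt0 adl; have p0 := level_gt0 adk.
have h2 := square_ge36; have N6 := N_ge6 t0 adk; have [_ c _ _ _] := adl.
move: p p' s' h1 p'0 p0 => x y z h1 y0 x0.
have hh : N * N <= z by rewrite mulnn; apply: leq_trans h1; rewrite leq_pmulr.
have h3 : 36 * y <= z by apply: leq_trans h1; rewrite leq_mul2r h2 orbT.
split=> //; first by nnia.
have tN : 3 * (t + 1) <= N by nnia.
apply: leq_trans hh; apply: leq_trans (leq_mul tN tN); nnia.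
Qed.

(** By [double_shift_le] a large block costs at least [t/2] times [p s'], whereas (C, D) on
    singletons falls short of [(t + 1) p s'] by at most [t/36] times that. *)
Lemma CD_singletons T : #|T| = t.+1 -> F = Cfam n k T -> H = Dfam n l t T -> singletons T.
Proof.
move=> cT eF eH; apply/forall_inP=> c cT'; apply: contraT => c1.
have [P PF] := set0Pn _ F0.
have sTP : T \subset P by move: PF; rewrite eF => /setIdP[].
have c0 := partition_neq0 (Pi_partition sF PF) (subsetP sTP _ cT').
have {c0} c2 : 1 < #|c| by rewrite ltn_neqAle eq_sym c1 card_gt0.
have leH : #|H| <= s' + t * h' by rewrite eH; apply: card_Dfam_block c2.
have leF : #|F| <= p by rewrite eF -cT; apply: card_Cfam_le; nlia.
have := lower_CD t0 adk adl maxFH; have := leq_mul leF leH; have := double_shift_le.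
have [] := numeric_facts.
move: #|F| #|H| p p' s' h' => f h x y z u h1 y0 x0 z0 _ hu le1 le2.
have a1 : 2 * (t * (x * u)) <= t * (x * z) by have := leq_mul (leqnn (t * x)) hu; nlia.
have a2 : 36 * (t * (x * y)) <= t * (x * z) by have := leq_mul (leqnn (t * x)) h1; nlia.
have a3 : 0 < t * (x * z) by rewrite !muln_gt0 t0 x0.
exfalso; nlia.
Qed.

Lemma card_Bfam_le X M : #|X| = t -> #|Bfam n l X M| <= #|Cfam n l X| + t.
Proof.
move=> cX; apply: leq_trans (leq_card_setU _ _) _; rewrite leq_add2l.
by rewrite -cX leq_imset_card.
Qed.

Lemma card_Afam_le X M : #|Afam n k X M| <= \sum_(b in M :\: X) #|Cfam n k (b |: X)|.
Proof.
apply: leq_card_sum_union => P /setIdP[PP /andP[sXP /set0Pn[b /setIP[bP bM]]]].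
by exists b => //; apply/setIdP; rewrite subUset sub1set bP.
Qed.

(** A large block in [X] roughly halves [Bfam]. A large block outside [X] halves one of the [l - t]
    terms of [Afam], provided [k >= t + 3]. For [k = t + 2] those terms are at most 1 and show no
    loss, whence the second alternative. *)
Lemma AB_singletons X M : X \subset M -> #|X| = t -> #|M| = l -> trivIset M ->
  set0 \notin M -> F = Afam n k X M -> H = Bfam n l X M ->
  singletons M \/ (k = t.+2 /\ #|F| * #|H| <= (l - t) * (s' + t)).
Proof.
move=> sXM cX cM tM M0 eF eH.
have [sM|/forall_inPn[c cM' c1]] := boolP (singletons M); [by left | right].
have c2 : 1 < #|c|.
  by rewrite ltn_neqAle eq_sym c1 card_gt0; apply: contraNneq M0 => <-.
have leC b : b \in M :\: X -> #|Cfam n k (b |: X)| <= p.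
  case/setDP=> _ bX; have := @card_Cfam_le n k (b |: X).
  by rewrite cardsU1 bX cX; apply; nlia.
have cMX : #|M :\: X| = l - t by rewrite cardsD (setIidPr sXM) cM cX.
have leF : #|F| <= (l - t) * p.
  rewrite eF; apply: leq_trans (card_Afam_le _ _) _.
  by rewrite -cMX -sum_nat_const; apply: leq_sum.
have lA := lower_AB t0 adk adl maxFH; have hq := next_level_step t0 adk.
have [n1 y0 x0 z0 n2] := numeric_facts; have [_ cl _ _ _] := adl.
have N6 := N_ge6 t0 adk.
have C2 := double_bin2_leq (l - t).
have C2' : 2 * ('C(l - t, 2) * (q * s')) <= (l - t) * ((l - t) * (q * s')).
  by have := leq_mul C2 (leqnn (q * s')); nlia.
have K2 : 2 <= l - t by nlia.
have hK : 2 * (l - t + 1) <= N by move: cl; nnia.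
have hKq : 4 * ((l - t) * ((l - t) * (q * s'))) <= p * s'.
  have : 4 * ((l - t) * (l - t)) <= N ^ 2 by rewrite -mulnn; nnia.
  move/leq_mul/(_ (leqnn q))/leq_trans/(_ hq)/leq_mul/(_ (leqnn s')).
  by move: p q s' => x y z; nlia.
have [cX'|cX'] := boolP (c \in X).
  have leH : #|H| <= h' + t.
    rewrite eH; apply: leq_trans (card_Bfam_le _ cX) _; rewrite leq_add2r -cX.
    by apply: card_Cfam_block cX' c2; nlia.
  have := leq_mul leF leH; have := double_shift_le.
  move: lA C2' hKq x0 z0 n2 K2; move: #|F| #|H| p q s' h' => f h x u z w.
  move: 'C(l - t, 2) (l - t) => C K lA C2' hKq x0 z0 n2 K2 hw le.
  have a0 : 0 < x * z by rewrite muln_gt0 x0.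
  have a1 : 2 * (K * (x * w)) <= K * (x * z) by have := leq_mul (leqnn (K * x)) hw; nlia.
  have a2 : 36 * (K * (x * t)) <= K * (x * z) by have := leq_mul (leqnn (K * x)) n2; nlia.
  have a3 : 2 * (x * z) <= K * (x * z) by rewrite leq_mul2r K2 orbT.
  exfalso; nlia.
have cMX' : c \in M :\: X by rewrite inE cX' cM'.
have leH : #|H| <= s' + t.
  rewrite eH; apply: leq_trans (card_Bfam_le _ cX) _; rewrite leq_add2r.
  by rewrite -cX; apply: card_Cfam_le; nlia.
have [k3|k2] := leqP t.+3 k; last first.
  have k2' : k = t.+2 by nlia.
  split=> //; apply: leq_trans (leq_mul leF leH) _.
  rewrite (_ : p = 1) ?muln1 //; rewrite (_ : k - t.+1 = 1); last by nlia.
  by rewrite (_ : n - t.+1 = (n - t.+2).+1) ?stir1 //; nlia.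
pose g := stir (n - t.+2) (k - t.+1).
have hg : 2 * g <= p.
  rewrite (_ : n - t.+1 = (n - t.+2).+1); last by nlia.
  by apply: leq_trans (stir_mulS _ _); rewrite leq_mul2r; apply/orP; right; nlia.
have {leF} leF : #|F| + p <= (l - t) * p + g.
  rewrite eF; have := card_Afam_le X M; rewrite (bigD1 c) //= => le.
  have le1 : #|Cfam n k (c |: X)| <= g.
    have := @card_Cfam_block n k (c |: X) c; rewrite cardsU1 cX' cX /g.
    by apply; rewrite ?setU11 //; nlia.
  have le2 : \sum_(b in M :\: X | b != c) #|Cfam n k (b |: X)| <= (l - t).-1 * p.
    apply: leq_trans (_ : \sum_(b in M :\: X | b != c) p <= _).
      by apply: leq_sum => b /andP[bM _]; apply: leC.
    rewrite sum_nat_const leq_mul2r; apply/orP; right.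
    rewrite -cMX (cardsD1 c (M :\: X)) cMX' /=.
    by apply/subset_leq_card/subsetP=> b /andP[bM bc]; rewrite in_setD1 bc.
  move: le le1 le2 K2; move: (\sum_(_ in _ | _) _) #|Cfam _ _ _| #|Afam _ _ _ _| (g) p; move: (l - t).
  by move=> a6 a1 a2 a3 a4 a5 le le1 le2 K2; nnia.
have hKt : 4 * ((l - t) * t) <= s'.
  have e1 : (l - t) * t <= N by move: cl; nnia.
  have e2 : N * N <= s' by rewrite mulnn; apply: leq_trans (level_step adl); rewrite leq_pmulr.
  by apply: leq_trans e2; nnia.
have := leq_mul leF leH.
move: lA C2' hKq x0 z0 n2 K2 hKt hg leH leF; move: (g) => {}g.
move: #|F| #|H| p q s' => f h x u z; move: 'C(l - t, 2) (l - t) => C K.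
move=> lA C2' hKq x0 z0 n2 K2 hKt hg leH leF le.
have a0 : 0 < x * z by rewrite muln_gt0 x0.
have a1 : 2 * (g * z) <= x * z by have := leq_mul hg (leqnn z); nlia.
have a2 : 2 * (g * t) <= x * t by have := leq_mul hg (leqnn t); nlia.
have a3 : 4 * (x * (K * t)) <= x * z by have := leq_mul (leqnn x) hKt; nlia.
have a4 : f * h + x * h <= K * x * (z + t) + g * (z + t) by nlia.
have a5 : f * h <= f * (z + t) by rewrite leq_mul2l leH orbT.
have a6 : f * (z + t) + x * (z + t) <= (K * x + g) * (z + t).
  by have := leq_mul leF (leqnn (z + t)); nlia.
have a7 : 36 * (x * t) <= x * z by have := leq_mul (leqnn x) n2; nlia.
exfalso; nlia.
Qed.

End Final.

(** * A one-element family at the index [t + 2] *)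

Section Single.
Variables (n t N k l : nat) (H : pfamily_of n) (P : spart n).
Implicit Types (G T W M X : spart n) (b c w x : block n).
Hypotheses (t0 : 0 < t) (adk : admissible n t N k) (adl : admissible n t N l).
Hypotheses (sF : [set P] \subset Pi n k) (sH : H \subset Pi n l).
Hypotheses (cross : cross_tint t [set P] H) (H0 : H != set0).
Hypothesis ntr : nontrivial t [set P] H.
Hypothesis maxFH : forall G1 G2 : pfamily_of n, G1 \subset Pi n k -> G2 \subset Pi n l ->
  cross_tint t G1 G2 -> nontrivial t G1 G2 -> #|G1| * #|G2| <= #|[set P]| * #|H|.
Hypotheses (k2 : k = t.+2) (big_n : 2 ^ (2 * t + 2) * N ^ 6 <= 2 ^ n).

Let tl : t.+2 <= l. Proof. by case: adl. Qed.
Let ln : l < n. Proof. by case: adl. Qed.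
Let F0 : [set P] != set0. Proof. by apply/set0Pn; exists P; rewrite inE. Qed.
Let pP : partition P setT. Proof. by apply: Pi_partition sF _; rewrite inE. Qed.
Let cP : #|P| = t.+2. Proof. by rewrite -k2; apply: Pi_card sF _; rewrite inE. Qed.

Local Notation p' := (stir (n - t.+1) (l - t.+1)).
Local Notation s' := (stir (n - t) (l - t)).
Local Notation h' := (stir (n - t.+1) (l - t)).

Section Largest.
Variable b : block n.
Hypotheses (bP : b \in P) (maxb : forall B, B \in P -> #|B| <= #|b|).
Let T := P :\ b.

Let cT : #|T| = t.+1.
Proof. by move: cP; rewrite (cardsD1 b P) bP add1n => -[]. Qed.

Lemma meet_or_pair G : G \in H -> t <= #|T :&: G| \/
  [/\ b \in G, #|T :\: G| = 2 & P :\: (T :\: G) \subset G].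
Proof.
move=> GH; have le : t <= #|P :&: G| by apply: cross; rewrite ?inE.
have [leT|ltT] := leqP t #|T :&: G|; [by left | right].
have eP : P :&: G = ([set b] :&: G) :|: (T :&: G) by rewrite -setIUl setD1K.
have bG : b \in G.
  apply: contraLR ltT => bG; rewrite -leqNgt; apply: leq_trans le _.
  by rewrite eP (_ : [set b] :&: G = set0) ?set0U //; apply/eqP; rewrite setI_eq0 disjoints1.
have b1 : #|[set b] :&: G| <= 1.
  by apply: leq_trans (subset_leq_card (subsetIl _ _)) _; rewrite cards1.
have le2 : t <= 1 + #|T :&: G|.
  apply: leq_trans le _; rewrite eP; apply: leq_trans (leq_card_setU _ _) _.
  by rewrite leq_add2r.
split=> //; first by rewrite cardsD cT; nlia.
apply/subsetP=> B; rewrite !inE => /andP[+ BP]; rewrite BP andbT negb_and negbK.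
by case/orP=> [//|]; rewrite negbK => /eqP->.
Qed.

(** The blocks of [W] are no larger than [b], so after fixing [P :\: W] at most [2 #|b|] points are
    free. Each of the other [n - t - v] points, if put back, would at least double the number of
    partitions. *)
Lemma pair_small W : W \subset T -> #|W| = 2 -> 4 * (t + 1) * #|through H (P :\: W)| <= s'.
Proof.
move=> sWT cW; have sWP : W \subset P by apply: subset_trans sWT (subD1set _ _).
have cPW : #|P :\: W| = t by rewrite cardsD (setIidPr sWP) cP cW; nlia.
have sPW : P :\: W \subset P by apply: subsetDl.
have [tPW PW0] := sub_partition_trivIset pP sPW.
have bPW : b \in P :\: W.
  by rewrite inE bP andbT; apply/negP=> /(subsetP sWT); rewrite !inE eqxx.
have := leq_card_cover_block tPW PW0 bPW; rewrite cPW => hu.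
pose u := #|cover (P :\: W)|; pose v := n - u.
have un : u <= n by rewrite -[X in _ <= X]card_ord max_card.
have b0 : 0 < #|b| by rewrite card_gt0 (partition_neq0 pP bP).
have vb : v <= 2 * #|b|.
  have tW : trivIset W by apply: trivIsetS sWP (partition_trivIset pP).
  have -> : v = #|~: cover (P :\: W)| by rewrite [#|~: _|]cardsCs setCK card_ord.
  apply: leq_trans (_ : #|cover W| <= _).
    apply/subset_leq_card/subsetP=> y; rewrite inE => ny.
    have : y \in cover P by rewrite (cover_partition pP).
    case/bigcupP=> B BP yB; apply/bigcupP; exists B => //; apply: contraR ny => BW.
    by apply/bigcupP; exists B => //; rewrite inE BW.
  rewrite card_cover // -cW -sum_nat_const; apply: leq_sum => B BW.
  by apply: maxb; apply: (subsetP sWP).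
have [_ ck _ _ _] := adk.
have wt : 4 * (t + 1) <= 2 ^ (n - t - v).
  apply: (pair_weight b0 t0 (N_ge6 t0 adk) _ big_n vb); first by nnia.
  by rewrite /v; move: hu un; rewrite -/u; nlia.
have vt : v + (n - t - v) = n - t by rewrite /v; move: hu un b0; rewrite -/u; nlia.
have := stir_mulX v (n - t - v) (_ : 2 <= l - t); rewrite vt.
have l2 : 1 < l - t by nlia.
move=> /(_ l2); apply: leq_trans; apply: leq_mul => //.
apply: leq_trans (subset_leq_card (through_Cfam _ sH)) _.
by rewrite card_Cfam ?cPW //; nlia.
Qed.

(** Members of [H] in [Dfam] number at most [s' + t h'], with [h' <= s' / 2]. The others omit one of
    the ['C(t.+1, 2)] pairs in [T], each contributing at most [s' / (4 (t + 1))]. In units of [s']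
    this gives [1 + t/2 + t/8], below the [1 + 35 t / 36] of (C, D). *)
Lemma single_bound c : c \in T -> 1 < #|c| -> 8 * #|H| <= (8 + 5 * t) * s'.
Proof.
move=> cT' c1; pose e := s' %/ (4 * (t + 1)).
have leH : #|H| <= (s' + t * h') + 'C(t.+1, 2) * e.
  rewrite -(cardsID (Dfam n l t T) H) leq_add //.
    apply: leq_trans (card_Dfam_block t0 adk adl cT cT' c1).
    exact/subset_leq_card/subsetIr.
  rewrite -cT -cards_draws.
  apply: (leq_card_union (B := fun W => through H (P :\: W))) => [G /setDP[GH nD]|W].
    have [tG|[bG cW sW]] := meet_or_pair GH.
      by case/negP: nD; apply/setIdP; rewrite (subsetP sH).
    by exists (T :\: G); rewrite inE ?GH // subsetDl cW.
  rewrite inE => /andP[sW /eqP cW]; rewrite leq_divRL; last by nlia.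
  by rewrite mulnC; apply: pair_small.
have hh := double_shift_le t0 adk adl.
have he : e * (4 * (t + 1)) <= s' by apply: leq_trunc_div.
have C2 : 2 * 'C(t.+1, 2) = (t + 1) * t by rewrite -mul_bin_diag bin1; nlia.
move: leH hh he C2; move: #|H| e h' s' 'C(t.+1, 2) => h e' u z C leH hh he C2.
have a1 : 8 * (C * e') = t * (e' * (4 * (t + 1))).
  by have : 2 * C * e' = (t + 1) * t * e' by [rewrite C2 |]; nlia.
have a2 : t * (e' * (4 * (t + 1))) <= t * z by rewrite leq_mul2l he orbT.
have a3 : t * (2 * u) <= t * z by rewrite leq_mul2l hh orbT.
nlia.
Qed.

Lemma single_contra c : c \in T -> 1 < #|c| -> False.
Proof.
move=> cT' c1; have bd := single_bound cT' c1.
have := lower_CD t0 adk adl maxFH; rewrite cards1 mul1n.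
have -> : stir (n - t.+1) (k - t.+1) = 1.
  have -> : k - t.+1 = 1 by nlia.
  by have -> : n - t.+1 = (n - t.+2).+1; [nlia | rewrite stir1].
have [h1 y0 x0 z0 _] := numeric_facts t0 adk adl.
move: p' s' #|H| bd h1 z0 => y z h bd h1 z0.
have a1 : t * (36 * y) <= t * z by rewrite leq_mul2l h1 orbT.
have a2 : 0 < t * z by rewrite muln_gt0 t0.
nlia.
Qed.

(** If [G] contains [b], its [l - 1 >= t + 1] other blocks share the [t + 1] points covered by [T];
    all of them are then singletons, so [T] lies in [G]. *)
Lemma single_singletons : singletons T -> tcover t H T.
Proof.
move=> sT; apply/tcoverP=> G GH; have [//|[bG _ _]] := meet_or_pair GH.
have pG := Pi_partition sH GH.
suff sTG : T \subset G by rewrite (setIidPl sTG) cT.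
apply/subsetP=> A AT; have /singletonsP/(_ _ AT)[y eA] := sT.
have yb : y \notin b.
  apply/negP=> yb; move: (AT); rewrite inE => /andP[ne AP]; case/negP: ne.
  rewrite inE; apply/eqP; apply: partition_block_eq pP AP bP _ yb.
  by rewrite eA inE.
have yc : y \in cover G by rewrite (cover_partition pG).
have BG := pblock_mem yc; have yB : y \in pblock G y by rewrite mem_pblock.
set B := pblock G y in BG yB.
have Bb : B != b by apply: contraNneq yb => <-.
have BGb : B \in G :\ b by rewrite !inE Bb.
have [tGb Gb0] := sub_partition_trivIset pG (subD1set G b).
have := leq_card_cover_block tGb Gb0 BGb.
have cGb : #|G :\ b| = l.-1.
  by have := Pi_card sH GH; rewrite (cardsD1 b G) bG add1n => <-.
have ccov : #|cover (G :\ b)| <= t.+1.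
  have [_ _ cc] := singletons_trivIset sT; rewrite -cT -cc.
  apply/subset_leq_card/subsetP=> z; rewrite (coverD1 (partition_trivIset pG) bG).
  by rewrite (coverD1 (partition_trivIset pP) bP) (cover_partition pG) (cover_partition pP).
rewrite cGb => le.
have B1 : #|B| <= 1.
  by rewrite -(leq_add2l l.-2); apply: leq_trans le _; apply: leq_trans ccov _; nlia.
suff <- : B = A by [].
rewrite eA; apply/eqP; rewrite eq_sym eqEcard sub1set yB cards1.
exact: B1.
Qed.

End Largest.

Lemma role_single : CD_form t k l [set P] H.
Proof.
have [b0 b0P] : exists b0, b0 \in P by apply/set0Pn; rewrite -card_gt0 cP.
case: (arg_maxnP (fun B : block n => #|B|) b0P) => b bP' maxb'.
have bP : b \in P := bP'.
have maxb B : B \in P -> #|B| <= #|b| := maxb' B.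
have [sT|/forall_inPn[c cT c1]] := boolP (singletons (P :\ b)).
  apply: (CD_form_of sF sH F0 H0 ntr maxFH (T := P :\ b)).
  - by move: cP; rewrite (cardsD1 b P) bP add1n => -[].
  - by move=> Q; rewrite inE => /eqP->; apply: subD1set.
  - exact: single_singletons.
case: (@single_contra b bP maxb c cT).
rewrite ltn_neqAle eq_sym c1 card_gt0 (partition_neq0 pP) //.
by move: cT; rewrite inE => /andP[].
Qed.

End Single.

(** * Relabelling the ground set *)

Section Relabel.
Variables (n : nat) (s : {perm 'I_n}).
Implicit Types (P Q X M T : spart n) (B : block n).

Lemma imset_perm_inj : injective (fun B : block n => s @: B).
Proof. exact: imset_inj perm_inj. Qed.

Lemma mem_perm_part B P : (s @: B \in perm_part s P) = (B \in P).
Proof. exact: mem_imset imset_perm_inj. Qed.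

Lemma imset_permT : s @: [set: 'I_n] = [set: 'I_n].
Proof.
by apply/setP=> y; rewrite !inE; apply/imsetP; exists (s^-1 y)%g; rewrite ?permKV ?inE.
Qed.

Lemma imset_permK B : s @: ((s^-1)%g @: B) = B.
Proof.
rewrite -imset_comp -[RHS]imset_id; apply: eq_imset => y /=.
exact: permKV.
Qed.

Lemma perm_partK P : perm_part s (perm_part (s^-1)%g P) = P.
Proof.
rewrite /perm_part -imset_comp -[RHS]imset_id; apply: eq_imset => B /=.
exact: imset_permK.
Qed.

Lemma perm_part_Pi k P : (perm_part s P \in Pi n k) = (P \in Pi n k).
Proof.
rewrite !inE /is_kpart -{1}imset_permT imset_partition; last exact: perm_inj.
by rewrite card_imset //; apply: imset_perm_inj.
Qed.

Lemma perm_part_subset X P : (perm_part s X \subset perm_part s P) = (X \subset P).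
Proof.
apply/idP/idP=> [/subsetP sXP|]; last exact: imsetS.
by apply/subsetP=> B BX; rewrite -mem_perm_part sXP // mem_perm_part.
Qed.

Lemma perm_part_inter P Q : perm_part s (P :&: Q) = perm_part s P :&: perm_part s Q.
Proof. by apply: imsetI => A B _ _; apply: imset_perm_inj. Qed.

Lemma perm_part_diff P Q : perm_part s (P :\: Q) = perm_part s P :\: perm_part s Q.
Proof.
apply/setP=> B; rewrite -(imset_permK B) mem_perm_part !in_setD.
by rewrite !mem_perm_part.
Qed.

Lemma perm_part_union P Q : perm_part s (P :|: Q) = perm_part s P :|: perm_part s Q.
Proof. exact: imsetU. Qed.

Lemma perm_part1 B : perm_part s [set B] = [set s @: B].
Proof. exact: imset_set1. Qed.

Lemma card_perm_part P : #|perm_part s P| = #|P|.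
Proof. exact: card_imset imset_perm_inj. Qed.

Lemma perm_part_eq0 P : (perm_part s P == set0) = (P == set0).
Proof. exact: imset_eq0. Qed.

Lemma cover_perm_part P : cover (perm_part s P) = s @: cover P.
Proof. by rewrite cover_imset imset_cover. Qed.

Lemma imset_permC (A : {set 'I_n}) : s @: (~: A) = ~: (s @: A).
Proof.
apply/setP=> y; rewrite -(permKV s y) in_setC !mem_imset ?in_setC //; exact: perm_inj.
Qed.

Lemma perm_fam_eq (F G : pfamily_of n) :
  (forall P, (perm_part s P \in F) = (P \in G)) -> perm_fam s G = F.
Proof.
move=> eFG; apply/setP=> P; apply/imsetP/idP=> [[Q QG ->]|PF]; first by rewrite eFG.
by exists (perm_part (s^-1)%g P); rewrite ?perm_partK // -eFG perm_partK.
Qed.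

Lemma perm_Cfam k T : perm_fam s (Cfam n k T) = Cfam n k (perm_part s T).
Proof.
apply: perm_fam_eq => P; apply/setIdP/setIdP;
by rewrite perm_part_Pi perm_part_subset.
Qed.

Lemma perm_Dfam l t T : perm_fam s (Dfam n l t T) = Dfam n l t (perm_part s T).
Proof.
apply: perm_fam_eq => P; apply/setIdP/setIdP;
by rewrite perm_part_Pi -perm_part_inter card_perm_part.
Qed.

Lemma perm_Afam k X M : perm_fam s (Afam n k X M) = Afam n k (perm_part s X) (perm_part s M).
Proof.
apply: perm_fam_eq => P; apply/setIdP/setIdP;
by rewrite perm_part_Pi perm_part_subset -perm_part_diff -perm_part_inter perm_part_eq0.
Qed.

Lemma perm_Bfam l X M : perm_fam s (Bfam n l X M) = Bfam n l (perm_part s X) (perm_part s M).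
Proof.
have ext B : perm_part s (M :\ B :|: [set B :|: ~: cover M]) =
    perm_part s M :\ (s @: B) :|: [set s @: B :|: ~: cover (perm_part s M)].
  rewrite perm_part_union perm_part_diff !perm_part1 imsetU imset_permC.
  by rewrite cover_perm_part.
apply: perm_fam_eq => P; apply/setUP/setUP => -[/setIdP[P1 P2]|/imsetP[B BX e]].
- by left; apply/setIdP; rewrite -perm_part_Pi -perm_part_subset.
- right; apply/imsetP; exists ((s^-1)%g @: B); first by rewrite -mem_perm_part imset_permK.
  apply: (imset_inj imset_perm_inj); rewrite -/(perm_part s P) e.
  by rewrite -[RHS]/(perm_part s _) ext imset_permK.
- by left; apply/setIdP; rewrite perm_part_Pi perm_part_subset.
- right; apply/imsetP; exists (s @: B); first by rewrite mem_perm_part.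
  by rewrite e ext.
Qed.

End Relabel.

(** List [A], then the rest of [M], then the remaining points. A single permutation must straighten
    both sets, because (A, B) depends on [X] and [M] together. *)
Lemma perm_initial_segments n (A M : {set 'I_n}) : A \subset M ->
  exists s : {perm 'I_n}, s @: [set i : 'I_n | i < #|A|] = A /\
                          s @: [set i : 'I_n | i < #|M|] = M.
Proof.
move=> sAM; pose e := enum A ++ enum (M :\: A) ++ enum (~: M).
have ue : uniq e.
  rewrite !cat_uniq !enum_uniq /= andbT; apply/andP; split; apply/hasPn=> x.
    rewrite mem_cat !mem_enum !inE => /orP[/andP[]//|].
    by apply: contra; apply: (subsetP sAM).
  by rewrite !mem_enum !inE => /negbTE->; rewrite andbF.
have me x : x \in e.
  rewrite !mem_cat !mem_enum !inE; case: (x \in A) => //=; case: (x \in M) => //.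
have se : size e = n.
  by rewrite -[RHS](card_ord n) -(card_uniqP ue); apply: eq_card => x; rewrite me.
(* The default is never reached: [e] has length [n]. *)
pose f (i : 'I_n) := nth i e i.
have fE (i : 'I_n) x0 : f i = nth x0 e i by apply: set_nth_default; rewrite se.
have inj : injective f.
  move=> i j; rewrite (fE j i) /f => /eqP; rewrite nth_uniq ?se // => /eqP.
  exact: val_inj.
pose s := perm inj.
have seg (B : {set 'I_n}) m : m = #|B| ->
    (forall i : 'I_n, i < m -> f i \in B) -> s @: [set i : 'I_n | i < m] = B.
  move=> em fB; apply/eqP; rewrite eqEcard; apply/andP; split.
    by apply/subsetP=> y /imsetP[i]; rewrite inE => im ->; rewrite permE fB.
  rewrite card_imset; last exact: perm_inj.
  have mn : m <= n by rewrite em -[X in _ <= X]card_ord max_card.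
  rewrite -em -[X in X <= _](card_sing mn) card_imset; last exact: set1_inj.
  by apply/subset_leq_card/subsetP=> i; rewrite !inE.
exists s; split; apply: seg => // i lti.
  by rewrite /f nth_cat -cardE lti -mem_enum mem_nth // -cardE.
rewrite /f nth_cat -cardE; case: ltnP => iA.
  by apply: (subsetP sAM); rewrite -mem_enum mem_nth // -cardE.
have lt2 : i - #|A| < size (enum (M :\: A)).
  by rewrite -cardE cardsD (setIidPr sAM) ltn_sub2r //; apply: leq_ltn_trans lti.
rewrite nth_cat lt2; suff : nth i (enum (M :\: A)) (i - #|A|) \in M :\: A.
  by case/setDP.
by rewrite -mem_enum mem_nth.
Qed.

Lemma perm_sing n m (s : {perm 'I_n}) (T : spart n) : singletons T ->
  s @: [set i : 'I_n | i < m] = cover T -> perm_part s (sing n m) = T.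
Proof.
move=> /singletonsP sT e; apply/setP=> B; apply/imsetP/idP.
  case=> C /imsetP[i im ->] ->; rewrite imset_set1.
  have : s i \in cover T by rewrite -e imset_f // inE.
  by case/bigcupP=> D DT; have [y eD] := sT _ DT; rewrite eD inE => /eqP->; rewrite -eD.
move=> BT; have [y eB] := sT _ BT; rewrite {}eB in BT *.
have : y \in cover T by apply/bigcupP; exists [set y]; rewrite ?inE.
rewrite -e => /imsetP[i im ey]; exists [set i]; last by rewrite imset_set1 -ey.
by apply: imset_f; move: im; rewrite !inE.
Qed.

Lemma exists_relabel n (X M : spart n) : X \subset M -> singletons M ->
  exists s : {perm 'I_n}, perm_part s (sing n #|X|) = X /\ perm_part s (sing n #|M|) = M.
Proof.
move=> sXM sM; have sX := singletonsS sXM sM.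
have [_ _ cX] := singletons_trivIset sX; have [_ _ cM] := singletons_trivIset sM.
have sub : cover X \subset cover M.
  by apply/bigcupsP=> B BX; apply: bigcup_sup; apply: (subsetP sXM).
have [s [e1 e2]] := perm_initial_segments sub; exists s.
by split; apply: perm_sing; rewrite -?cX -?cM.
Qed.

(** * Identification of a maximal pair up to relabelling *)

Section OneRole.
Variables (n t N k l : nat) (F H : pfamily_of n).
Hypotheses (t0 : 0 < t) (adk : admissible n t N k) (adl : admissible n t N l).
Hypotheses (sF : F \subset Pi n k) (sH : H \subset Pi n l).
Hypotheses (cross : cross_tint t F H) (F0 : F != set0) (H0 : H != set0).
Hypothesis ntr : nontrivial t F H.
Hypothesis maxFH : forall G1 G2 : pfamily_of n, G1 \subset Pi n k -> G2 \subset Pi n l ->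
  cross_tint t G1 G2 -> nontrivial t G1 G2 -> #|G1| * #|G2| <= #|F| * #|H|.
Hypothesis big_n : 2 ^ (2 * t + 2) * N ^ 6 <= 2 ^ n.

Lemma role_forms (X : spart n) : #|X| = t -> tcover t F X ->
  CD_form t k l F H \/ AB_form t k l F H.
Proof.
move=> cX covX; have XF P : P \in F -> X \subset P := tcover_subset cX covX.
(* Were [X] a cover of [H] too, its [t] blocks would be common to both families. *)
have nX : ~~ tcover t H X.
  apply/negP=> covXH; move: ntr; rewrite /nontrivial -cX; apply/negP; rewrite -leqNgt.
  apply/subset_leq_card/subsetP=> B BX; rewrite inE; apply/forall_inP=> P.
  case/setUP=> PF; apply: subsetP BX; first exact: XF.
  exact: tcover_subset covXH PF.
have tk : t.+2 <= k by case: adk.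
have [k3|k2] := leqP t.+3 k.
  by apply: (role_generic t0 adk adl sF sH cross F0 H0 ntr maxFH cX XF nX); left.
have [F1|F1] := leqP #|F| 1; last first.
  by apply: (role_generic t0 adk adl sF sH cross F0 H0 ntr maxFH cX XF nX); right.
have /cards1P[P eF] : #|F| == 1 by rewrite eqn_leq F1 card_gt0.
left; have ek : k = t.+2 by nlia.
clear XF nX covX; move: sF cross F0 ntr maxFH; rewrite eF => sP crP P0 ntP mxP.
exact: role_single t0 adk adl sP sH crP H0 ntP mxP ek big_n.
Qed.

(** The third alternative, with blocks of [M] undetermined, is refuted by [no_tie] and
    [no_reversed]. *)
Lemma role_iso (X : spart n) : #|X| = t -> tcover t F X ->
  [\/ iso_pair F H (C2 n k t) (D2 n l t), iso_pair F H (A3 n k l t) (B2 n l t)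
    | k = t.+2 /\ #|F| * #|H| <= (l - t) * (stir (n - t) (l - t) + t)].
Proof.
move=> cX /(role_forms cX)[[T [cT eF eH]]|[Y [M [sYM cY cM [tM M0] [eF eH]]]]].
  have sT := CD_singletons t0 adk adl sF F0 maxFH cT eF eH.
  have [s [_ e2]] := exists_relabel (subxx T) sT; rewrite cT in e2.
  by constructor 1; exists s; rewrite perm_Cfam perm_Dfam e2.
have [sM|h] := AB_singletons t0 adk adl maxFH sYM cY cM tM M0 eF eH.
  have [s [e1 e2]] := exists_relabel sYM sM; rewrite cY cM in e1 e2.
  by constructor 2; exists s; rewrite perm_Afam perm_Bfam e1 e2.
by constructor 3.
Qed.

End OneRole.

(* Both indices equal to [t + 2]: the pair (A, B) loses to (C, D) once [t > 1]. *)
Lemma no_tie n t N B : 1 < t -> admissible n t N t.+2 ->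
  (forall G1 G2 : pfamily_of n, G1 \subset Pi n t.+2 -> G2 \subset Pi n t.+2 ->
    cross_tint t G1 G2 -> nontrivial t G1 G2 -> #|G1| * #|G2| <= B) ->
  B <= (t.+2 - t) * (stir (n - t) (t.+2 - t) + t) -> False.
Proof.
move=> t1 ad mx; have t0 : 0 < t by lia.
have := lower_CD t0 ad ad mx; have [h1 y0 x0 z0 h2] := numeric_facts t0 ad ad.
have e : stir (n - t.+1) (t.+2 - t.+1) = 1.
  have kn : t.+2 < n by case: ad.
  have -> : t.+2 - t.+1 = 1 by lia.
  by have -> : n - t.+1 = (n - t.+2).+1; [lia | rewrite stir1].
rewrite e in h1 *; have -> : t.+2 - t = 2 by lia.
move: h1 h2; have -> : t.+2 - t = 2 by lia.
by move: (stir (n - t) 2) => z h1 h2 le1 le2; clear -t1 h1 h2 le1 le2; nia.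
Qed.

(* For [k = t + 2 < l] the pair (B, A) loses to (C, D) with the roles exchanged. *)
Lemma no_reversed n t N l B : 0 < t -> admissible n t N t.+2 -> admissible n t N l ->
  t.+3 <= l -> 10 <= n - l ->
  (forall G1 G2 : pfamily_of n, G1 \subset Pi n l -> G2 \subset Pi n t.+2 ->
    cross_tint t G1 G2 -> nontrivial t G1 G2 -> #|G1| * #|G2| <= B) ->
  B <= (l - t) * (stir (n - t) (l - t) + t) -> False.
Proof.
move=> t0 ad2 adl l3 gap mx leB.
have := lower_CD t0 adl ad2 mx; have [_ _ _ _ h2] := numeric_facts t0 adl adl.
have p0 := level_gt0 adl.
have -> : t.+2 - t.+1 = 1 by lia.
have -> : t.+2 - t = 2 by lia.
have -> : stir (n - t.+1) 1 = 1.
  by have -> : n - t.+1 = (n - t.+2).+1; [lia | rewrite stir1].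
have -> : stir (n - t) 2 = (2 ^ (n - t).-1).-1.
  by rewrite -stir2; congr (stir _ _); lia.
rewrite muln1.
have := stir_ratio_upper (n - l) (l - t - 3).
have -> : (l - t - 3).+3 + (n - l) = n - t by lia.
have -> : (l - t - 3).+2 + (n - l) = n - t.+1 by lia.
have -> : (l - t - 3).+3 = l - t by lia.
have -> : (l - t - 3).+2 = l - t.+1 by lia.
have eE : 2 ^ (n - t).-1 = 2 ^ (n - l) * 2 ^ (l - t).-1.
  by rewrite -expnD; congr (_ ^ _); lia.
have Klt : l - t <= 2 ^ (l - t).-1.
  by have := ltn_expl (l - t).-1 (ltnSn 1); lia.
(* [stir_ratio_upper] bounds [s' / p] by a multiple of [(3/2) ^ (n - l)], while the exchanged (C, D)
   gains a power of 2. The inequality [6 * 3 ^ m < 4 ^ m] holds from [m = 7] on, and the gap [n - l]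
   is at least 10. *)
have gp : 6 * 3 ^ (n - l) < 2 ^ (n - l) * 2 ^ (n - l).
  rewrite -expnMn -[2 * 2]/4 (_ : n - l = (n - l - 7) + 7); last by lia.
  rewrite !expnD mulnA [6 * _]mulnC -mulnA.
  apply: leq_ltn_trans (_ : 4 ^ (n - l - 7) * (6 * 3 ^ 7) < _).
    rewrite leq_mul2r; apply/orP; right; case: (n - l - 7) => // m.
    by rewrite leq_exp2r.
  have c7 : 6 * 3 ^ 7 < 4 ^ 7 by lia.
  by rewrite ltn_pmul2l // expn_gt0.
have K0 : 0 < l - t by lia.
have E3 : 2 <= 2 ^ (n - t).-1 by rewrite -{1}(expn1 2) leq_exp2l //; lia.
rewrite [2 ^ (n - l).+1]expnS [3 ^ (n - l).+1]expnS eE; rewrite {}eE in E3.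
move: leB h2 p0; move: (stir (n - t.+1) _) (stir (n - t) _) => x z.
move: Klt gp E3 K0; move: (2 ^ (n - l)) (3 ^ (n - l)) (2 ^ (l - t).-1) => a b c.
move: (l - t) => K.
move=> Kc gp E3 K0 leB h2 x0 up low; clear mx adl ad2 l3 gap.
have low2 : x * (2 * (a * c).-1) <= B + x.
  have : (t - 1) * x <= (t - 1) * (x * (a * c).-1).
    by rewrite leq_mul2l leq_pmulr ?orbT //; lia.
  by move: low; case: t t0 {h2 leB} => // m _; rewrite subSS subn0; lia.
have zt : K * (z + t) <= K * (2 * z) by rewrite leq_mul2l; apply/orP; right; lia.
have h1 : 2 * (x * (a * c)) <= 2 * (K * z) + 3 * x.
  have : x * (a * c) = x * (a * c).-1 + x by case: (a * c) E3 => // m _; rewrite mulnS addnC.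
  by lia.
have h3 : a * (2 * (x * (a * c))) <= a * (2 * (K * z) + 3 * x) by rewrite leq_mul2l h1 orbT.
have h4 : 2 * K * (a * z + 2 * a * x) <= 2 * K * (3 * b * x) by rewrite leq_mul2l up orbT.
have h5 : 3 * (a * x) <= 4 * (K * (a * x)) by rewrite leq_mul // leq_pmull.
have h6 : 6 * b * (K * x) <= a * a * (c * x).
  by apply: leq_mul; [exact: ltnW | rewrite leq_mul2r Kc orbT].
have h7 : 0 < a * a * (c * x).
  have : 0 < a * c by lia.
  by rewrite !muln_gt0 x0 => /andP[-> ->].
lia.
Qed.

Theorem theorem1p4 (n t k1 k2 : nat) (F1 F2 : pfamily_of n) :
  0 < t -> t + 2 <= k2 -> k2 <= k1 -> (k1, k2) <> (3, 3) ->
  Rle (Rmult (INR 2) (L k1 t)) (INR n) ->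
  F1 \subset Pi n k1 -> F2 \subset Pi n k2 ->
  cross_tint t F1 F2 -> nontrivial t F1 F2 ->
  (forall G1 G2 : pfamily_of n, G1 \subset Pi n k1 -> G2 \subset Pi n k2 ->
     cross_tint t G1 G2 -> nontrivial t G1 G2 ->
     #|G1| * #|G2| <= #|F1| * #|F2|) ->
  iso_pair F1 F2 (A3 n k1 k2 t) (B2 n k2 t) \/
  iso_pair F1 F2 (B2 n k1 t) (A3 n k2 k1 t) \/
  iso_pair F1 F2 (C2 n k1 t) (D2 n k2 t) \/
  iso_pair F1 F2 (D2 n k1 t) (C2 n k2 t).
Proof.
move=> t0; rewrite addn2 => tk2 k21 ne33 /threshold_nat; set N := (t + 1) * _ => big.
move=> sF1 sF2 cr ntr mx.
pose K := k1 - t; have K2 : 2 <= K by rewrite /K; nlia.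
have eK : K + t = k1 by rewrite /K; nlia.
have ad k : t.+2 <= k -> k <= k1 -> admissible n t N k.
  move=> tk kk1; have kK : k <= K + t by nlia.
  split=> //.
  - by rewrite /N leq_mul2l; apply/orP; right; nlia.
  - by have := ground_large t0 K2 big; nlia.
  - by move=> s ts sk; apply: (stir_step t0 K2 big).
  - exact: (stir_two_large t0 K2 big).
have ad1 : admissible n t N k1 by apply: ad; nlia.
have ad2 : admissible n t N k2 by apply: ad; nlia.
have big6 := pow_ground6 t0 K2 big; have gap := gap_large t0 K2 big.
rewrite eK in gap.
have mx' (G1 G2 : pfamily_of n) : G1 \subset Pi n k2 -> G2 \subset Pi n k1 ->
    cross_tint t G1 G2 -> nontrivial t G1 G2 -> #|G1| * #|G2| <= #|F2| * #|F1|.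
  move=> s1 s2 c12 n12; rewrite mulnC [X in _ <= X]mulnC; apply: mx => //.
    exact: cross_tintC.
  by move: n12; rewrite /nontrivial /common_blocks setUC.
have ntr' : nontrivial t F2 F1 by move: ntr; rewrite /nontrivial /common_blocks setUC.
have cr' := cross_tintC cr.
(* An empty family would give product 0, below the value of (C, D). *)
have prod0 : 0 < #|F1| * #|F2|.
  have := lower_weak t0 ad1 ad2 mx; have [_ _ x0 z0 _] := numeric_facts t0 ad1 ad2.
  rewrite lt0n => le; apply/eqP=> e0; move: le; rewrite e0 muln0 leqn0 !muln_eq0.
  by move: x0 z0; rewrite !lt0n => /negbTE-> /negbTE->.
have [F10 F20] : F1 != set0 /\ F2 != set0.
  by move: prod0; rewrite muln_gt0 !card_gt0 => /andP[].
have [/existsP[X /andP[/eqP cX covX]]|noX] :=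
    boolP [exists X : spart n, (#|X| == t) && tcover t F1 X].
  have [h|h|[ek le]] := role_iso t0 ad1 ad2 sF1 sF2 cr F10 F20 ntr mx big6 cX covX.
  - by do 2 right; left.
  - by left.
  (* The larger index equals [t + 2], so both do, and excluding (3, 3) means [t > 1]. *)
  have ek2 : k2 = t.+2 by apply/eqP; rewrite eqn_leq tk2 andbT -ek.
  move: mx le ad1 ne33; rewrite ek ek2 => mxt le adt ne33.
  case: (no_tie _ adt mxt le); rewrite ltn_neqAle t0 andbT.
  by apply/eqP=> e; apply: ne33; rewrite -e.
have [/existsP[X /andP[/eqP cX covX]]|noY] :=
    boolP [exists X : spart n, (#|X| == t) && tcover t F2 X].
  have swap (A B : pfamily_of n) : iso_pair F2 F1 A B -> iso_pair F1 F2 B A.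
    by case=> s [e1 e2]; exists s.
  have [/swap h|/swap h|[ek le]] := role_iso t0 ad2 ad1 sF2 sF1 cr' F20 F10 ntr' mx' big6 cX covX.
  - by do 3 right.
  - by right; left.
  (* Only the smaller index is known to be [t + 2] here: a larger [k1] is handled by exchanging the
     roles in (C, D), an equal one as a tie. *)
  have [k3|k3] := leqP t.+3 k1.
    rewrite ek in ad2 mx; rewrite mulnC in le.
    by case: (no_reversed t0 ad2 ad1 k3 gap mx le).
  have ek1 : k1 = t.+2 by apply/eqP; rewrite eqn_leq -ltnS k3 -ek.
  move: mx' le ad1 ne33; rewrite ek ek1 => mxt le adt ne33.
  case: (no_tie _ adt mxt le); rewrite ltn_neqAle t0 andbT.
  by apply/eqP=> e; apply: ne33; rewrite -e.
have no (G : pfamily_of n) : G != set0 ->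
    ~~ [exists X : spart n, (#|X| == t) && tcover t G X] ->
    forall T, tcover t G T -> t.+1 <= #|T|.
  move=> G0 /existsPn noT T covT; rewrite ltn_neqAle (leq_tcover G0 covT) andbT.
  by move: (noT T); rewrite covT andbT eq_sym.
have le := no_cover_bound t0 ad1 ad2 sF1 sF2 cr F10 F20 k21 (no _ F10 noX) (no _ F20 noY).
by case: (weak_contra t0 ad1 ad2 mx le).
Qed.
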